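(* Let $n\geq 4$ be even and $m\geq 3$ odd, and let $\Gamma$ be an Abelian group of order $mn$. Suppose $\Gamma$ has a subgroup $H$ of order $m$ such that the quotient group $K=\Gamma/H$ has a subgroup isomorphic to $Z_2\oplus Z_{2s}$ for some $s\geq 2$. Then the Dutch windmill graph $D_n^m$ is $\Gamma$-harmonious.
   Context: The Dutch windmill graph $D_n^m$ consists of $m$ copies of the cycle $C_n$ sharing exactly one common vertex (the central vertex) and otherwise vertex-disjoint; it has $mn$ edges. For a graph $G=(V,E)$ with $q$ edges and a finite Abelian group $\Gamma$ of order $q$ (written additively), $G$ is called $\Gamma$-harmonious if there is an injection $f:V\to\Gamma$ such that the induced edge labeling $w(xy)=f(x)+f(y)$ is a bijection from $E$ to $\Gamma$. $Z_k$ denotes the cyclic group of order $k$. *)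

(* Defs.v *)
From HB Require Import structures.
From mathcomp Require Import all_boot all_order all_algebra all_fingroup.
From mathcomp Require Import all_solvable.

Set Implicit Arguments.
Unset Strict Implicit.
Unset Printing Implicit Defensive.

Import GRing.Theory.

(* A simple graph is given by its adjacency relation; an edge is the
   two-element set of its end points. *)
Definition edges (V : finType) (adj : rel V) : {set {set V}} :=
  [set [set x; y] | x in V, y in V & adj x y].

Definition edge_label (V : finType) (Gamma : finZmodType) (f : V -> Gamma)
    (A : {set V}) : Gamma :=
  (\sum_(x in A) f x)%R.

Lemma edge_label2 (V : finType) (Gamma : finZmodType) (f : V -> Gamma)
    (x y : V) :
  x != y -> edge_label f [set x; y] = (f x + f y)%R.
Proof.
by move=> nxy; rewrite /edge_label big_setU1 ?inE //= big_set1.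
Qed.

(* The bijectivity clauses force the number of edges to be #|Gamma|. *)
Definition harmonious (V : finType) (adj : rel V) (Gamma : finZmodType) :
    Prop :=
  exists f : V -> Gamma,
    [/\ injective f,
        {in edges adj &, injective (edge_label f)}
      & edge_label f @: edges adj = [set: Gamma]].

(* [None] is the central vertex, at position 0 of every copy of the cycle;
   [Some (i, j)] is the vertex at position j.+1 of the i-th copy. *)
Definition windmill_vertex (n m : nat) : finType :=
  option ('I_m * 'I_n.-1)%type.

Definition windmill_pos (n m : nat) (u : windmill_vertex n m) : nat :=
  if u is Some (_, j) then j.+1 else 0.

Definition windmill_same_copy (n m : nat) : rel (windmill_vertex n m) :=
  fun u v =>
    match u, v with
    | Some (i, _), Some (i', _) => i == i'
    | _, _ => true
    end.

Definition cycle_adj (n : nat) : rel nat :=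
  fun a b => (b == a.+1 %% n) || (a == b.+1 %% n).

Definition dutch_windmill (n m : nat) : rel (windmill_vertex n m) :=
  fun u v =>
    windmill_same_copy u v && cycle_adj n (windmill_pos u) (windmill_pos v).

Lemma dutch_windmill_sym (n m : nat) : symmetric (@dutch_windmill n m).
Proof.
move=> u v; rewrite /dutch_windmill /cycle_adj orbC; congr (_ && _).
by case: u v => [[i j]|] [[i' j']|] //=; rewrite eq_sym.
Qed.

Lemma dutch_windmill_irr (n m : nat) :
  1 < n -> irreflexive (@dutch_windmill n m).
Proof.
move=> n_gt1 u; rewrite /dutch_windmill /cycle_adj orbb.
have lt_un : windmill_pos u < n.
  case: u => [[i j]|] /=; last exact: ltnW.
  by move: (ltn_ord j); rewrite ltn_predRL.
apply/negbTE; rewrite negb_and; apply/orP; right.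
move: lt_un; rewrite leq_eqVlt => /orP[/eqP un|lt_un].
  by rewrite un modnn -lt0n -ltnS un.
by rewrite modn_small // neq_ltn ltnSn.
Qed.

(* Main.v *)
(* Idea.  A cyclic ordering a_0, ..., a_(n-1) of K = Gamma / H whose consecutive
   sums exhaust K yields the labelling a_j + h (h in H) of the windmill, because
   doubling is a bijection of the group H of odd order.

   Such an ordering exists for every finite abelian K with two distinct
   involutions and an element z with 2z <> 0, by induction on #|K|.  An ordering
   lifts along a quotient by a cyclic group of odd order by going round
   several times.  Along a quotient by a Klein four-group, an affine lift only
   produces two cycles, for parity reasons; they are merged by trading three
   edges for three others on the same vertices with the same sums.  The
   induction therefore carries along three edges of the ordering that allow
   such a trade ([good]); the fact that merging reverses part of a cycle creates
   them anew.  The groups that cannot be reduced in this way are of the form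
   Z_2 x Z_2s, Z_2 x Z_2 x Z_2s or Z_4 x Z_4, and get explicit orderings. *)
Require Import Defs.
From HB Require Import structures.
From mathcomp Require Import all_boot all_order all_algebra all_fingroup.
From mathcomp Require Import all_solvable zify.

Set Implicit Arguments.
Unset Strict Implicit.
Unset Printing Implicit Defensive.

Import GRing.Theory.
Local Open Scope ring_scope.

(** Both conditions on K are forced when #|K| is even. Adding up all edge sums of an ordering counts
    every element twice, so the elements of K have sum 0; this fails when there is exactly one
    involution. In an elementary 2-group the sum 0 would require two equal neighbours.

    The parity obstacle: the map v -> sigma v between neighbouring fibres of a Klein quotient must
    make both sigma and 1 + sigma bijective. An affine such sigma on F_4 is multiplication by a
    generator of F_4^* followed by a translation, hence a 3-cycle and an even permutation of the
    four points. Going once round the ordering is then an even permutation as well, whereas a single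
    lifted cycle would need a 4-cycle, which is odd. The lift chosen here has one pass that closes
    up on itself and three passes that follow each other. *)

Section Sums.
Variable M : nmodType.
Implicit Types s : seq M.

Definition isum s : seq M := behead (pairmap +%R 0 s).
(** The closing sum comes first, so that the edge leaving position [j] has index [j.+1] modulo the
    length. *)
Definition csum s : seq M := (last 0 s + head 0 s) :: isum s.

Lemma isum_cons x y s : isum (x :: y :: s) = (x + y) :: isum (y :: s).
Proof. by []. Qed.

Lemma isum_cat s1 s2 : s1 != [::] -> s2 != [::] ->
  isum (s1 ++ s2) = isum s1 ++ (last 0 s1 + head 0 s2) :: isum s2.
Proof.
case: s1 => // x s1 _; case: s2 => // y s2 _.
elim: s1 x => [|z s1 IH] x //.
by rewrite 2!cat_cons isum_cons -cat_cons IH.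
Qed.

Lemma head0_cat s1 s2 : s1 != [::] -> head 0 (s1 ++ s2) = head 0 s1.
Proof. by case: s1. Qed.

Lemma last0_cat s1 s2 : s2 != [::] -> last 0 (s1 ++ s2) = last 0 s2.
Proof. by case: s2 => // y s2 _; rewrite last_cat. Qed.

Lemma cat_neq0l s1 s2 : s1 != [::] -> s1 ++ s2 != [::].
Proof. by case: s1. Qed.

Lemma cat_neq0r s1 s2 : s2 != [::] -> s1 ++ s2 != [::].
Proof. by case: s1 s2. Qed.

Lemma rev_neq0 s : s != [::] -> rev s != [::].
Proof. by rewrite -!size_eq0 size_rev. Qed.

Lemma head0_rev s : head 0 (rev s) = last 0 s.
Proof. by case/lastP: s => // s x; rewrite rev_rcons last_rcons. Qed.

Lemma last0_rev s : last 0 (rev s) = head 0 s.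
Proof. by case: s => // x s; rewrite rev_cons last_rcons. Qed.

Lemma isum_rev s : isum (rev s) = rev (isum s).
Proof.
case: s => // x s; elim: s x => // y s IH x.
rewrite rev_cons -cats1 isum_cat // ?rev_neq0 // IH last0_rev /= cats1.
by rewrite rev_cons addrC.
Qed.

Lemma size_isum s : size (isum s) = (size s).-1.
Proof. by rewrite size_behead size_pairmap. Qed.

(* Relinking [U0 V0 W0] and [U1 D B] into a single cycle trades three of the
   old closing or internal edges for three new ones with the same sums. *)
Lemma csum_merge (U0 V0 W0 U1 D B : seq M) g :
  U0 != [::] -> V0 != [::] -> W0 != [::] ->
  U1 != [::] -> D != [::] -> B != [::] ->
  last 0 U1 + head 0 D = last 0 V0 + head 0 U1 ->
  last 0 V0 + head 0 W0 = last 0 B + last 0 U1 ->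
  last 0 B + head 0 U1 = head 0 D + head 0 W0 ->
  g \in csum (U0 ++ V0 ++ W0) ++ csum (U1 ++ D ++ B) ->
  g \in csum (B ++ rev U1 ++ rev V0 ++ rev U0 ++ rev W0 ++ D).
Proof.
move=> nU0 nV0 nW0 nU1 nD nB r1 r2 r3.
rewrite /csum !(isum_cat, head0_cat, last0_cat)
  ?(cat_neq0l, rev_neq0, isum_rev) //.
rewrite !(head0_rev, last0_rev, isum_rev, mem_cat, in_cons, mem_rev).
rewrite r1 r2 r3 [head 0 U1 + _]addrC [head 0 V0 + _]addrC.
rewrite [head 0 U0 + _]addrC [head 0 W0 + _]addrC.
do ![case/orP | by move=> ->; rewrite ?orbT].
Qed.

Lemma mem_merge (U0 V0 W0 U1 D B : seq M) g :
  g \in (U0 ++ V0 ++ W0) ++ U1 ++ D ++ B ->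
  g \in B ++ rev U1 ++ rev V0 ++ rev U0 ++ rev W0 ++ D.
Proof.
rewrite !(mem_cat, mem_rev).
do ![case/orP | by move=> ->; rewrite ?orbT].
Qed.

Lemma mem_isum_catl s1 s2 : {subset isum s1 <= isum (s1 ++ s2)}.
Proof.
move=> g; case: (eqVneq s1 [::]) => [->|n1] //.
case: (eqVneq s2 [::]) => [->|n2]; first by rewrite cats0.
by rewrite isum_cat // mem_cat => ->.
Qed.

Lemma mem_isum_catr s1 s2 : {subset isum s2 <= isum (s1 ++ s2)}.
Proof.
move=> g; case: (eqVneq s1 [::]) => [->|n1] //.
case: (eqVneq s2 [::]) => [->|n2] //.
by rewrite isum_cat // mem_cat in_cons => ->; rewrite !orbT.
Qed.

Lemma nth_isum s k : (k.+1 < size s)%N ->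
  nth 0 (isum s) k = nth 0 s k + nth 0 s k.+1.
Proof. by rewrite nth_behead => lt_k; rewrite (nth_pairmap 0). Qed.

Lemma mem_isum_nth s k : (k.+1 < size s)%N ->
  nth 0 s k + nth 0 s k.+1 \in isum s.
Proof.
move=> lt_k; rewrite -nth_isum // mem_nth // size_isum -ltnS prednK //.
exact: leq_trans lt_k.
Qed.

End Sums.

Lemma map_isum (M N : nmodType) (f : {additive M -> N}) (s : seq M) :
  isum (map f s) = map f (isum s).
Proof.
case: s => // x s; elim: s x => // y s IH x.
by rewrite [map f _]/= isum_cons -[_ :: map f s]/(map f (y :: s)) IH /= raddfD.
Qed.

Lemma last0_map (M N : nmodType) (f : {additive M -> N}) (s : seq M) :
  last 0 (map f s) = f (last 0 s).
Proof. by rewrite -[X in last X _](raddf0 f) last_map. Qed.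

Lemma surj_section (G Q : finZmodType) (pi : G -> Q) :
  (forall q, exists g, pi g = q) -> exists sec, cancel sec pi.
Proof.
move=> pi_surj; exists (fun q => odflt 0 [pick g | pi g == q]) => q.
case: pickP => [g /eqP //|no]; have [g gq] := pi_surj q.
by move: (no g); rewrite gq eqxx.
Qed.

(** Covering passes through the lifts more easily than distinctness, which follows from it by
    counting, see [harm_uniq]. *)
Definition harm (G : finZmodType) (s : seq G) : Prop :=
  [/\ size s = #|G|, forall g, g \in s & forall g, g \in csum s].

(* The two equations say that the edges joining the end of [U] to [V], the end
   of [V] to [W] and the end of [W] to [U] can be traded for three other edges
   on the same six vertices with the same sums. *)
Definition good (G : finZmodType) : Prop := exists U V W : seq G,
  [/\ harm (U ++ V ++ W), [/\ 1 < size U, 0 < size V & 1 < size W]%N,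
      last 0 U + head 0 V = last 0 V + head 0 U
    & last 0 V + head 0 W = last 0 W + last 0 U].

(** * Lifting along a Klein four-group *)

Section KleinLift.
Variables (G Q : finZmodType) (pi : {additive G -> Q}) (t1 t2 : G).
Hypotheses (t1_2 : t1 + t1 = 0) (t2_2 : t2 + t2 = 0).
Hypotheses (pi_t1 : pi t1 = 0) (pi_t2 : pi t2 = 0).
Hypothesis ker_pi : forall g, pi g = 0 -> g \in [:: 0; t1; t2; t1 + t2].
Hypothesis pi_surj : forall q, exists g, pi g = q.
Hypothesis card_G : #|G| = (4 * #|Q|)%N.

(* The nonzero elements of the Klein group as powers of a generator of F_4^*:
   [klein k + klein k.+1 = klein k.+2]. *)
Definition klein (k : nat) : G := nth 0 [:: t1; t2; t1 + t2] (k %% 3).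

Lemma klein_mod k k' : k = k' %[mod 3]%N -> klein k = klein k'.
Proof. by rewrite /klein => ->. Qed.

Lemma mod3P k : [\/ k %% 3 = 0, k %% 3 = 1 | k %% 3 = 2]%N.
Proof.
have := ltn_pmod k (isT : 0 < 3)%N.
by case: (k %% 3)%N => [|[|[]]] // _; [apply: Or31|apply: Or32|apply: Or33].
Qed.

(** Two distinct nonzero elements of a Klein group add up to the third one, and the three residues
    modulo 3 have sum 0; [2 * (m + k)] is [- (m + k)] modulo 3. *)
Lemma kleinD m k : (m %% 3 != k %% 3)%N -> klein m + klein k = klein (2 * (m + k))%N.
Proof.
rewrite /klein -modnMmr -[((m + k) %% 3)%N]modnDm.
case: (mod3P m) => ->; case: (mod3P k) => -> //= _.
- by rewrite addrA t1_2 add0r.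
- exact: addrC.
- by rewrite addrC -addrA t2_2 addr0.
- by rewrite addrAC t1_2 add0r.
- by rewrite -addrA t2_2 addr0.
Qed.

Lemma kleinK k : klein k + klein k = 0.
Proof.
rewrite /klein; case: (mod3P k) => -> //=.
by rewrite addrACA t1_2 t2_2 addr0.
Qed.

Lemma pi_klein k : pi (klein k) = 0.
Proof.
by rewrite /klein; case: (mod3P k) => -> //=; rewrite raddfD pi_t1 pi_t2 addr0.
Qed.

Lemma ker_klein g : pi g = 0 -> g = 0 \/ exists k, g = klein k.
Proof.
move/ker_pi; rewrite !inE => /or4P[] /eqP->; [by left|right..].
- by exists 0%N.
- by exists 1%N.
- by exists 2.
Qed.

Fixpoint twist k (s : seq G) : seq G :=
  if s is x :: s' then (x + klein k) :: twist k.+1 s' else [::].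

Lemma size_twist k s : size (twist k s) = size s.
Proof. by elim: s k => //= x s IH k; rewrite IH. Qed.

Lemma twist_neq0 k s : s != [::] -> twist k s != [::].
Proof. by case: s. Qed.

Lemma twist_cat k s1 s2 :
  twist k (s1 ++ s2) = twist k s1 ++ twist (k + size s1)%N s2.
Proof. by elim: s1 k => [|x s IH] k /=; rewrite ?addn0 // IH addSnnS. Qed.

Lemma head_twist k s : s != [::] -> head 0 (twist k s) = head 0 s + klein k.
Proof. by case: s. Qed.

Lemma last_twist k s :
  s != [::] -> last 0 (twist k s) = last 0 s + klein (k + (size s).-1)%N.
Proof.
case/lastP: s => // s x _.
by rewrite -cats1 twist_cat !last_cat size_cat /= addn1.
Qed.

(** This is the benefit of using powers of a generator: the edge sums of a twisted list are
    themselves twisted, so the fibres of edges are covered by the same argument as the fibres of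
    vertices. *)
Lemma isum_twist k s : isum (twist k s) = twist k.+2 (isum s).
Proof.
case: s => // x s; elim: s x k => // y s IH x k.
rewrite [twist k _]/= isum_cons -[_ :: twist k.+2 s]/(twist k.+1 (y :: s)) IH.
rewrite isum_cons /= addrACA kleinD ?(@klein_mod _ k.+2) //; lia.
Qed.

(** The position [j] does not depend on [k], so the passes with different offsets can be compared at
    the same vertex. *)
Lemma mem_twist s b :
  b \in s -> exists j, forall k, b + klein (k + j)%N \in twist k s.
Proof.
elim: s => // x s IH; rewrite in_cons => /orP[/eqP->|/IH[j jP]].
  by exists 0%N => k; rewrite addn0 mem_head.
by exists j.+1 => k; rewrite -addSnnS /= in_cons jP orbT.
Qed.

(* One cycle of [Q] lifts to a cycle [s] and, going round three times, to
   [three_twists 0 c s]; the step [c] must be such that the passes close up with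
   the right sums, which depends on the length of [s] modulo 3. *)
Definition three_twists (d c : nat) (s : seq G) : seq G :=
  twist d s ++ twist (d + c)%N s ++ twist (d + 2 * c)%N s.

Lemma three_offsets (d c j k : nat) : ((c == 1) || (c == 2))%N ->
  exists i, [\/ i = d, i = (d + c)%N | i = (d + 2 * c)%N] /\
            (i + j = k %[mod 3])%N.
Proof.
move=> c12; case: (mod3P (k + 2 * (d + j))) => kd.
- by exists d; split; [apply: Or31|lia].
- case/orP: c12 => /eqP ->.
  + by exists (d + 1)%N; split; [apply: Or32|lia].
  + by exists (d + 4)%N; split; [apply: Or33|lia].
case/orP: c12 => /eqP ->.
- by exists (d + 2)%N; split; [apply: Or33|lia].
- by exists (d + 2)%N; split; [apply: Or32|lia].
Qed.

Lemma mem_three_twists (d c k : nat) s b : ((c == 1) || (c == 2))%N ->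
  b \in s -> b + klein k \in three_twists d c s.
Proof.
move=> c12 /mem_twist[j jP]; rewrite /three_twists !mem_cat.
have [i [di /klein_mod <-]] := three_offsets d j k c12.
by case: di => ->; rewrite jP ?orbT.
Qed.

Lemma cover_fiber (s : seq G) (d c : nat) g : ((c == 1) || (c == 2))%N ->
  pi g \in map pi s -> g \in s ++ three_twists d c s.
Proof.
move=> c12 /mapP[b bs gb].
have /ker_klein[/subr0_eq ->|[k gk]] : pi (g - b) = 0 by rewrite raddfB gb subrr.
  by rewrite mem_cat bs.
by rewrite mem_cat -(subrK b g) gk addrC mem_three_twists ?orbT.
Qed.

(** Inner edges are covered like vertices. The junctions between passes lie over the closing edge:
    there the offsets [i * c + (size s).-1] and [i.+1 * c] meet. They must differ modulo 3 to have a
    nonzero sum, which is the condition on [c]; the three sums are then distinct because they differ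
    by multiples of [2 * c]. *)
Lemma csum_three_twists (s : seq G) (c : nat) g : s != [::] ->
  ((c == 1) && (size s %% 3 != 2) || (c == 2) && (size s %% 3 != 0))%N ->
  pi g \in csum (map pi s) -> g \in csum s ++ csum (three_twists 0 c s).
Proof.
move=> s0 cP; have c12 : ((c == 1) || (c == 2))%N.
  by case/orP: cP => /andP[->]; rewrite ?orbT.
have sz : (0 < size s)%N by rewrite lt0n size_eq0.
rewrite /csum in_cons => /orP[|]; last first.
  rewrite map_isum => /(cover_fiber 2 c12).
  rewrite !mem_cat !in_cons => /orP[-> //|]; rewrite ?orbT //.
  rewrite /three_twists !(addSn, add0n) !isum_cat ?cat_neq0l ?twist_neq0 //.
  rewrite !isum_twist !(mem_cat, in_cons).
  by case/or3P=> ->; rewrite !orbT.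
rewrite (_ : last 0 _ + _ = pi (last 0 s + head 0 s)); last first.
  by rewrite raddfD; case: (s) s0 => //= x s' _; rewrite last_map.
move/eqP => gb; have /ker_klein[] : pi (g - (last 0 s + head 0 s)) = 0.
    by rewrite raddfB gb subrr.
  by move/subr0_eq ->; rewrite mem_cat mem_head.
case=> k gk; rewrite -(subrK (last 0 s + head 0 s) g) gk.
rewrite /three_twists !isum_cat ?cat_neq0l ?twist_neq0 //.
rewrite !last0_cat ?cat_neq0r ?twist_neq0 // !head0_cat ?twist_neq0 //.
rewrite !head_twist // !last_twist //.
have kap x z : last 0 s + x + (head 0 s + z) = last 0 s + head 0 s + (x + z).
  exact: addrACA.
rewrite !kap !kleinD; try by case/orP: c12 => /eqP c_eq; move: cP; rewrite c_eq /=; lia.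
set p := (size s).-1.
have : [\/ k = 2 * (0 + 2 * c + p + 0) %[mod 3],
           k = 2 * (0 + p + (0 + c)) %[mod 3]
         | k = 2 * (0 + c + p + (0 + 2 * c)) %[mod 3]]%N.
  case/orP: c12 => /eqP ->; case: (mod3P (k + p)) => kp;
    first [by apply: Or31; lia | by apply: Or32; lia | by apply: Or33; lia].
rewrite mem_cat addrC in_cons => -[] /klein_mod ->; apply/orP; right.
- by rewrite in_cons eqxx.
- by rewrite in_cons mem_cat in_cons eqxx !orbT.
- by rewrite in_cons !(mem_cat, in_cons) eqxx !orbT.
Qed.

(** The merge needs the passes of offsets 0 and 2; the latter is the second pass if [c = 2] and the
    third if [c = 1]. The final offset [e] depends on the length only: it has to be known before the
    lift is fixed, since two vertices of the lift are defined through it. *)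
Lemma three_twists_split (q : nat) : exists c e : nat,
  ((c == 1) && (q %% 3 != 2) || (c == 2) && (q %% 3 != 0))%N /\
  forall s, s != [::] -> size s = q -> exists P1 P2,
    [/\ three_twists 0 c s = twist 0 s ++ P1 ++ twist 2 s ++ P2,
        last 0 (twist 2 s ++ P2) = last 0 s + klein e
      & (size P1 + size P2 = q)%N].
Proof.
case: (eqVneq (q %% 3)%N 2) => q3.
  exists 2, (4 + q.-1)%N; split=> [|s s0 sq]; first by rewrite q3.
  exists [::], (twist 4 s); split=> //; last by rewrite size_twist.
  by rewrite last0_cat ?twist_neq0 // last_twist ?sq.
exists 1%N, (2 + q.-1)%N; split=> [//|s s0 sq].
exists (twist 1 s), [::]; split; rewrite ?cats0 ?size_twist ?addn0 //.
by rewrite last_twist ?sq.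
Qed.

(* The lifts of the six vertices of the trade in [Q] must satisfy its equations
   in [G] exactly, which dictates the lifts [b0], [b1] of the ends of [U].  The new
   trade uses three lifts of the first edge of [W], one of which is traversed
   backwards after the merge. *)
Lemma good_klein : good Q -> good G.
Proof.
case=> U [V [W [[szX covX sumX] [sU sV sW] r1 r2]]].
have [sec secK] := surj_section pi_surj.
have r3 : last 0 W + head 0 U = head 0 V + head 0 W.
  by apply: (addrI (last 0 V)); rewrite addrCA -r1 [RHS]addrCA r2 addrA addrC.
case: U sU szX covX sumX r1 r2 r3 => // a0 U; case/lastP: U => // U a1 _.
case: W sW => // w [//|y Y] _.
case: V sV => // v V _; rewrite [last 0 (a0 :: _)]last_rcons /=.
move=> szX covX sumX r1 r2 r3.
set q := #|Q|.
have [c [e [cq tt]]] := three_twists_split q.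
set nU := (size U).+2; set nV := (size V).+1.
set BV := sec v :: map sec V; set BY := sec y :: map sec Y.
pose lB := last 0 BY + klein e.
(* [b0] and [b1] solve the last two equations of [csum_merge], with [lB] as the end of the second
   cycle and [klein 0], [klein nU.-1] as the offsets of the ends of its copy of [U]. In [Q] these
   equations are [r3] and [r2], so [b0] and [b1] still lie over [a0] and [a1]. *)
pose b0 := sec v + klein nU + sec w - (lB + klein 0).
pose b1 := last 0 BV + sec w - (lB + klein nU.-1).
set BU := b0 :: rcons (map sec U) b1.
pose B := BU ++ BV ++ [:: sec w] ++ BY.
have piV : map pi BV = v :: V by rewrite /= mapK ?secK.
have piY : map pi BY = y :: Y by rewrite /= mapK ?secK.
have lastV : pi (last 0 BV) = last v V by rewrite -last0_map piV.
have lastY : pi (last 0 BY) = last y Y by rewrite -last0_map piY.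
have pib0 : pi b0 = a0.
  rewrite raddfB !raddfD /= lastY !pi_klein !subr0 !addr0 !secK -r3.
  by rewrite addrC addKr.
have pib1 : pi b1 = a1.
  rewrite raddfB !raddfD /= lastY lastV !pi_klein !subr0 !secK r2.
  by rewrite addrC addKr.
have piB : map pi B = (a0 :: rcons U a1) ++ (v :: V) ++ w :: y :: Y.
  rewrite /B !map_cat piV piY -[map pi [:: _]]/[:: pi (sec w)] secK.
  by rewrite [map pi BU]/= map_rcons mapK // pib0 pib1.
have sB : size B = q by rewrite -(size_map pi) piB; exact: szX.
have nB : B != [::] by [].
have [P1 [P2 [ttB lastP sP]]] := tt B nB sB.
have cov g : g \in B ++ three_twists 0 c B.
  by apply: cover_fiber; [case/orP: cq => /andP[->]; rewrite ?orbT|rewrite piB].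
have sums g : g \in csum B ++ csum (three_twists 0 c B).
  by apply: csum_three_twists; rewrite ?sB // piB.
rewrite ttB in cov sums.
have nBU : BU != [::] by [].
have nBV : BV != [::] by [].
have nBY : BY != [::] by [].
have sBU : size BU = nU by rewrite /= size_rcons size_map.
have sBV : size BV = nV by rewrite /= size_map.
have twB k : twist k B = twist k BU ++ twist (k + nU)%N BV ++
   [:: sec w + klein (k + nU + nV)%N] ++ twist (k + nU + nV + 1)%N BY.
  by rewrite /B !twist_cat sBU sBV.
pose m := (nU + nV)%N.
pose D := twist nU BV ++ [:: sec w + klein m] ++ twist m.+1 BY ++ P1 ++
   twist 2 BU ++ twist (2 + nU)%N BV ++ [:: sec w + klein m.+2].
pose E := twist m.+3 BY ++ P2.
have splitB : twist 0 B ++ P1 ++ twist 2 B ++ P2 = twist 0 BU ++ D ++ E.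
  by rewrite !twB /D /E /m !addSn !add0n !addn1 -!catA.
have lastE : last 0 E = lB.
  rewrite /lB -(_ : last 0 B = last 0 BY); last by rewrite /B !last_cat.
  rewrite -lastP twB (_ : (2 + nU + nV + 1)%N = m.+3); last by rewrite addn1.
  by rewrite /E !last_cat.
(* The three new edges all join lifts of [w] and [y]; the first runs from [sec y] to [sec w],
   against the direction of the other two. Their equations reduce to [klein m = klein m.+3] and
   [klein m + klein m.+1 = klein m.+2]. *)
exists (E ++ rev (twist 0 BU) ++ rev BV ++ rev BU ++ rev BY),
  ([:: sec w] ++ twist nU BV ++ [:: sec w + klein m]),
  (twist m.+1 BY ++ P1 ++
   twist 2 BU ++ twist (2 + nU)%N BV ++ [:: sec w + klein m.+2]).
have newE : (E ++ rev (twist 0 BU) ++ rev BV ++ rev BU ++ rev BY) ++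
    ([:: sec w] ++ twist nU BV ++ [:: sec w + klein m]) ++
    (twist m.+1 BY ++ P1 ++
      twist 2 BU ++ twist (2 + nU)%N BV ++ [:: sec w + klein m.+2]) =
    E ++ rev (twist 0 BU) ++ rev BV ++ rev BU ++ rev ([:: sec w] ++ BY) ++ D.
  by rewrite [rev (_ ++ BY)]rev_cat /D -!catA.
have headE : head 0 E = sec y + klein m.+3 by [].
have lBU : last 0 BU = b1 by rewrite /BU /= last_rcons.
have lU1 : last 0 (twist 0 BU) = b1 + klein nU.-1.
  by rewrite last_twist // lBU sBU.
have F1 : b1 + klein nU.-1 = last 0 BV + sec w - lB.
  by rewrite /b1 opprD addrA subrK.
have F0 : b0 + klein 0 = sec v + klein nU + sec w - lB.
  by rewrite /b0 opprD addrA subrK.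
have lastU' : last 0 (E ++ rev (twist 0 BU) ++ rev BV ++ rev BU ++ rev BY) = sec y.
  by rewrite !catA last0_cat ?rev_neq0 // last0_rev.
have lastV' : last 0 ([:: sec w] ++ twist nU BV ++ [:: sec w + klein m]) =
    sec w + klein m by rewrite !catA last_cat.
have lastW' : last 0 (twist m.+1 BY ++ P1 ++ twist 2 BU ++
    twist (2 + nU)%N BV ++ [:: sec w + klein m.+2]) = sec w + klein m.+2.
  by rewrite !catA last_cat.
split.
- rewrite newE; split.
  + have := congr1 size splitB; rewrite card_G -/q.
    rewrite !(size_cat, size_rev) !size_twist sB.
    have : (size BU + (size BV + (1 + size BY)) = q)%N by rewrite -sB !size_cat.
    move: sP; move: (size D) (size E) (size BU) (size BV) (size BY).
    by rewrite [size [:: _]]/=; lia.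
  + by move=> g; apply: mem_merge; rewrite -splitB.
  + move=> g; apply: csum_merge; rewrite -?splitB //.
    * rewrite lU1 F1 [head 0 D]/= [head 0 (twist 0 BU)]/= F0.
      by rewrite [LHS]addrC !addrA [_ + last 0 BV]addrC addrA.
    * by rewrite lastE lU1 F1 [RHS]addrC subrK.
    * by rewrite lastE [head 0 (twist 0 BU)]/= F0 [LHS]addrC subrK.
- by rewrite !size_cat /= !size_rev /=; split; lia.
- rewrite lastU' lastV' !head0_cat //= -(@klein_mod m); last by lia.
  by rewrite addrACA kleinK addr0 addrC.
- rewrite lastU' lastV' lastW' [head 0 _]/= addrACA kleinD; last by lia.
  rewrite [in RHS]addrAC; congr (_ + _); apply: klein_mod; lia.
Qed.

End KleinLift.

(** * Lifting along an odd cyclic group *)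

Section OddLift.
Variables (G Q : finZmodType) (pi : {additive G -> Q}) (y : G) (n : nat).
Hypotheses (n_even : ~~ odd n) (y_n : y *+ n.+1 = 0) (pi_y : pi y = 0).
Hypothesis ker_pi : forall g, pi g = 0 -> exists k, g = y *+ k.
Hypothesis pi_surj : forall q, exists g, pi g = q.
Hypothesis card_G : #|G| = (n.+1 * #|Q|)%N.

Lemma mulrn_mod k : y *+ (k %% n.+1) = y *+ k.
Proof.
by rewrite [in RHS](divn_eq k n.+1) mulrnDr mulnC mulrnA y_n mul0rn add0r.
Qed.

(** [(n.+2)./2] is the inverse of 2 modulo the odd number [n.+1]. *)
Lemma half_multiple k : exists2 i, (i <= n)%N & y *+ (2 * i) = y *+ k.
Proof.
exists ((k * (n.+2)./2) %% n.+1)%N; first by rewrite -ltnS ltn_pmod.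
rewrite -mulrn_mod modnMmr mulnCA mul2n halfK oddS oddS (negbTE n_even) subn0.
by rewrite -addn1 mulnDr muln1 addnC -modnDmr modnMl addn0 mulrn_mod.
Qed.

Definition shift i (s : seq G) := [seq b + y *+ i | b <- s].

Definition shifts m k (s : seq G) := flatten [seq shift i s | i <- iota m k].

Lemma shiftsD m k k' s : shifts m (k + k') s = shifts m k s ++ shifts (m + k) k' s.
Proof. by rewrite /shifts iotaD map_cat flatten_cat. Qed.

Lemma shifts1 m s : shifts m 1 s = shift m s.
Proof. by rewrite /shifts /= cats0. Qed.

Lemma size_shifts m k s : size (shifts m k s) = (k * size s)%N.
Proof.
elim: k m => [|k IH] m //.
by rewrite -add1n shiftsD size_cat IH shifts1 size_map mulnDl mul1n.
Qed.

Lemma isum_shift i s : isum (shift i s) = shift (2 * i) (isum s).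
Proof.
case: s => // x s; elim: s x => // z s IH x.
rewrite [shift i _]/= isum_cons -[_ :: map _ s]/(shift i (z :: s)) IH /=.
by rewrite addrACA -mulrnDr addnn mul2n.
Qed.

(** Pass [i] adds [y *+ i] to the vertices, hence [y *+ (2 * i)] to its inner edges and
    [y *+ (2 * i).+1] at the junction with the next pass. Both families exhaust the multiples of
    [y], as the number of passes is odd. The trade is placed in the last pass. *)
Lemma good_odd_lift : good Q -> good G.
Proof.
case=> U [V [W [[szX covX sumX] [sU sV sW] r1 r2]]].
have [sec secK] := surj_section pi_surj.
case: U sU szX covX sumX r1 r2 => // a0 U; case/lastP: U => // U a1 _.
case: W sW => // w W; rewrite ltnS => sW.
case: V sV => // v V _; rewrite [last 0 (a0 :: _)]last_rcons.
rewrite [head 0 _]/= [head 0 _]/= [head 0 _]/=.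
move=> szX covX sumX r1 r2.
set BV := sec v :: map sec V; set BW := sec w :: map sec W.
have piV : map pi BV = v :: V by rewrite /= mapK ?secK.
have piW : map pi BW = w :: W by rewrite /= mapK ?secK.
have lastV : pi (last 0 BV) = last 0 (v :: V) by rewrite -last0_map piV.
have lastW : pi (last 0 BW) = last 0 (w :: W) by rewrite -last0_map piW.
pose b1 := last 0 BV + sec w - last 0 BW.
(* The term [y *+ n] compensates for the head of the new [U] lying in pass 0, while the other five
   vertices of the trade lie in pass [n]. *)
pose b0 := b1 + sec v - last 0 BV + y *+ n.
have pib1 : pi b1 = a1.
  by rewrite raddfB raddfD lastV lastW secK r2 addrC addKr.
have pib0 : pi b0 = a0.
  rewrite raddfD raddfMn pi_y mul0rn addr0 raddfB raddfD lastV secK pib1 r1.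
  by rewrite addrC addKr.
set BU := b0 :: rcons (map sec U) b1.
pose B := BU ++ BV ++ BW.
have piB : map pi B = (a0 :: rcons U a1) ++ (v :: V) ++ w :: W.
  by rewrite /B /BU !map_cat piV piW /= map_rcons pib0 pib1 mapK.
have sB : size B = #|Q| by rewrite -szX -piB size_map.
pose L := shifts 0 n.+1 B.
have split_shifts i : (i <= n)%N ->
    L = shifts 0 i B ++ shift i B ++ shifts i.+1 (n - i) B.
  move=> le_in; rewrite /L -(subnKC le_in) -addnS shiftsD add0n -[(n - i).+1]add1n.
  by rewrite shiftsD shifts1 addn1 subnKC.
have nshift i : shift i B != [::] by [].
have fiber (s : seq G) g : pi g \in map pi s ->
    exists2 b, b \in s & exists k, g = b + y *+ k.
  case/mapP=> b bs gb; exists b => //.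
  have [k gk] : exists k, g - b = y *+ k by apply: ker_pi; rewrite raddfB gb subrr.
  by exists k; rewrite -gk [RHS]addrC subrK.
have cov g : g \in L.
  have /fiber[b bB [k ->]] : pi g \in map pi B by rewrite piB.
  have le_i : (k %% n.+1 <= n)%N by rewrite -ltnS ltn_pmod.
  by rewrite (split_shifts _ le_i) !mem_cat -mulrn_mod (map_f (fun b => b + _)) ?orbT.
have last_shift j s : s != [::] -> last 0 (shift j s) = last 0 s + y *+ j.
  by case: s => // x s _; rewrite [LHS]last_map.
have lastL : last 0 L = last 0 B + y *+ n.
  by rewrite (split_shifts n) // subnn cats0 last0_cat // last_shift.
have headL : head 0 L = b0 by rewrite /= addr0.
have sums g : g \in csum L.
  have : pi g \in csum (map pi B) by rewrite piB.
  rewrite in_cons => /orP[|]; last first.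
    rewrite map_isum => /fiber[b bB [k ->]].
    have [i le_i <-] := half_multiple k.
    rewrite in_cons (split_shifts _ le_i); apply/orP; right.
    apply: mem_isum_catr; apply: mem_isum_catl.
    by rewrite isum_shift (map_f (fun b => b + _)).
  rewrite last0_map [head 0 _]/= -raddfD => /eqP pig.
  have [k ->] : exists k, g = last 0 B + b0 + y *+ k.
    have [k gk] : exists k, g - (last 0 B + b0) = y *+ k.
      by apply: ker_pi; rewrite raddfB pig subrr.
    by exists k; rewrite -gk [RHS]addrC subrK.
  (* Junction [i] has offset [2 * i + 1], so [2 * i] must be [k - 1], that is [k + n] modulo [n.+1].
     For [i = n] the junction is the closing edge. *)
  have [i le_i ik] := half_multiple (k + n)%N.
  have {ik} <- : y *+ (2 * i).+1 = y *+ k.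
    by rewrite mulrSr ik -mulrSr -addnS mulrnDr y_n addr0.
  move: le_i; rewrite leq_eqVlt => /orP[/eqP i_n|lt_i].
    rewrite /csum in_cons lastL headL i_n.
    by rewrite mul2n -addnn -addnS mulrnDr y_n addr0 addrAC eqxx.
  rewrite in_cons (split_shifts i) 1?ltnW //.
  rewrite (_ : (n - i = (n - i.+1).+1)%N); last by lia.
  rewrite catA isum_cat; [|exact: cat_neq0r|by []].
  rewrite mem_cat in_cons; apply/orP; right; apply/orP; right; apply/orP; left.
  rewrite [last 0 (_ ++ shift _ _)]last0_cat // last_shift //.
  rewrite [head 0 _]/= addrACA -mulrnDr addnS addnn mul2n; exact: eqxx.
exists (shifts 0 n B ++ shift n BU), (shift n BV), (shift n BW).
have shift_cat s1 s2 : shift n (s1 ++ s2) = shift n s1 ++ shift n s2.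
  exact: map_cat.
have lastU : last 0 (shift n BU) = b1 + y *+ n.
  by rewrite last_shift // /BU /= last_rcons.
have headU : head 0 (shifts 0 n B ++ shift n BU) = b0.
  by case: (n) => [|n1] /=; rewrite addr0.
split.
- rewrite -catA -!shift_cat.
  have -> : shifts 0 n B ++ shift n (BU ++ BV ++ BW) = L.
    by rewrite (split_shifts n) // subnn cats0.
  by split=> //; rewrite size_shifts sB card_G.
- rewrite size_cat !size_map /= size_rcons; split=> //; first by lia.
  by rewrite size_map.
- rewrite last0_cat // lastU headU last_shift // [head 0 _]/= /b0.
  by rewrite addrACA [RHS]addrACA [last 0 BV + _]addrC subrK.
- rewrite last0_cat // lastU !last_shift // [head 0 _]/= /b1.
  by rewrite addrACA [RHS]addrACA [last 0 BW + _]addrC subrK.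
Qed.

End OddLift.

(** * Labelling the windmill *)

Lemma harm_uniq (G : finZmodType) (s : seq G) :
  harm s -> uniq s /\ uniq (csum s).
Proof.
case=> sz cov sums.
have sub (t : seq G) : (size t <= #|G|)%N -> (forall g, g \in t) -> uniq t.
  move=> le_t ct; apply: (@leq_size_uniq _ (enum G)) => [|g _|] //.
    exact: enum_uniq.
  by rewrite -cardE.
split; apply: sub => //; first by rewrite sz.
by rewrite /csum /= size_isum prednK sz // -sz lt0n size_eq0; case: (s) (cov 0).
Qed.

Section Windmill.
Variables (G Q : finZmodType) (pi : {additive G -> Q}) (n m : nat) (H : {set G}).
Hypotheses (n_ge4 : (4 <= n)%N) (m_odd : odd m).
Hypothesis ker_pi : forall g, (pi g == 0) = (g \in H).
Hypothesis H_m : forall g, g \in H -> g *+ m = 0.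
Hypothesis pi_surj : forall q, exists g, pi g = q.
Hypotheses (card_G : #|G| = (m * n)%N) (card_H : #|H| = m) (card_Q : #|Q| = n).

(** The image of an edge label in [Q] determines the position of the edge, the sums of [s] being
    distinct. At a fixed position, an edge at the centre carries [h i] once and any other edge
    carries it twice; both determine [i]. Surjectivity follows by counting the edges. *)
Lemma dutch_windmill_harmonious (s : seq Q) :
  harm s -> harmonious (@dutch_windmill n m) G.
Proof.
move=> hs; have [us usum] := harm_uniq hs; case: hs => sz cov sums.
have [sec secK] := surj_section pi_surj.
pose a k := sec (nth 0 s k).
pose h (i : 'I_m) := enum_val (cast_ord (esym card_H) i).
have h_inj : injective h by move=> i i' /enum_val_inj/cast_ord_inj.
have pi_h i : pi (h i) = 0 by apply/eqP; rewrite ker_pi enum_valP.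
have pi_a k : pi (a k) = nth 0 s k by rewrite secK.
pose lab (v : windmill_vertex n m) :=
  if v is Some (i, j) then a j.+1 + h i else a 0%N.
pose vtx (i : 'I_m) (k : nat) : windmill_vertex n m :=
  if k is k'.+1 then omap (fun j => (i, j)) (insub k') else None.
pose e (p : 'I_m * 'I_n) := [set vtx p.1 p.2; vtx p.1 (p.2.+1 %% n)%N].
have n_gt0 : (0 < n)%N by lia.
have pos_vtx i k : (k < n)%N -> windmill_pos (vtx i k) = k.
  case: k => //= k lt_k; have lt_k' : (k < n.-1)%N by lia.
  by rewrite insubT.
have pi_lab i k : (k < n)%N -> pi (lab (vtx i k)) = nth 0 s k.
  case: k => /= [|k] lt_k; first exact: pi_a.
  have lt_k' : (k < n.-1)%N by lia.
  by rewrite insubT /= raddfD pi_h addr0 pi_a.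
have lab_vtx i k : (k.+1 < n)%N -> lab (vtx i k.+1) = a k.+1 + h i.
  move=> lt_k; have lt_k' : (k < n.-1)%N by lia.
  by rewrite /= insubT /=.
have succ_neq (k : 'I_n) : (k != k.+1 %% n :> nat)%N.
  have := ltn_ord k; rewrite leq_eqVlt => /orP[/eqP kn|lt_k].
    by rewrite kn modnn; lia.
  by rewrite modn_small //; lia.
have label_e p : edge_label lab (e p) =
    lab (vtx p.1 p.2) + lab (vtx p.1 (p.2.+1 %% n)%N).
  apply: edge_label2; apply/eqP => /(congr1 (@windmill_pos n m)).
  by rewrite !pos_vtx ?ltn_pmod // => /eqP; rewrite (negbTE (succ_neq _)).
have double_inj i i' : h i + h i = h i' + h i' -> i = i'.
  move=> hh; apply: h_inj; apply/eqP; rewrite -subr_eq0; apply/eqP.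
  set d := h i - h i'.
  have d2 : d *+ 2 = 0 by rewrite mulrnBl !mulr2n hh subrr.
  have : d *+ m = 0 by apply: H_m; rewrite -ker_pi raddfB !pi_h subrr.
  by rewrite -[m]odd_double_half m_odd -mul2n mulrnDr mulrnA d2 mul0rn addr0.
have phi_inj : injective (fun p => edge_label lab (e p)).
  move=> [i k] [i' k']; rewrite !label_e /= => eq_l.
  have eq_k : k = k'.
    have nth_csum (j : 'I_n) :
        nth 0 s j + nth 0 s (j.+1 %% n)%N = nth 0 (csum s) (j.+1 %% n)%N.
      have := ltn_ord j; rewrite leq_eqVlt => /orP[/eqP jn|lt_j].
        by rewrite jn modnn nth0 /csum [RHS]/= -nth_last sz card_Q -[n in n.-1]jn.
      by rewrite modn_small //= nth_isum // sz card_Q.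
    have := congr1 pi eq_l; rewrite !raddfD !pi_lab ?ltn_pmod // !nth_csum => /eqP.
    have szc : size (csum s) = n by rewrite /= size_isum prednK sz card_Q.
    rewrite nth_uniq ?szc ?ltn_pmod // => /eqP eq_j; apply: val_inj => /=.
    have mod_succ (j : 'I_n) : (j.+1 %% n = if j.+1 == n then 0 else j.+1)%N.
      case: eqP => [->|jn]; first exact: modnn.
      by apply: modn_small; have := ltn_ord j; lia.
    have := ltn_ord k; have := ltn_ord k'; move: eq_j; rewrite !mod_succ.
    by case: eqP => k1; case: eqP => k2; lia.
  rewrite -{}eq_k in eq_l *; congr (_, _); move: eq_l.
  case: (posnP k) => [k0|].
    rewrite k0 modn_small ?lab_vtx //=; try by lia.
    by move/addrI/addrI/h_inj.
  case: (leqP n k.+1) => [n_le|lt_k] k_gt0.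
    have -> : k.+1 = n by have := ltn_ord k; lia.
    rewrite modnn -(prednK k_gt0) !lab_vtx; try by have := ltn_ord k; lia.
    by move/addIr/addrI/h_inj.
  rewrite modn_small // -(prednK k_gt0) !lab_vtx; try by lia.
  by rewrite addrACA [RHS]addrACA => /addrI/double_inj.
have vtx_pos i (v : windmill_vertex n m) :
    (if v is Some (i', _) then i' == i else true) -> v = vtx i (windmill_pos v).
  by case: v => [[i' j] /eqP ->|] //; rewrite /vtx /= valK.
have lt_pos (v : windmill_vertex n m) : (windmill_pos v < n)%N.
  by case: v => //= -[_ j]; have := ltn_ord j; lia.
have edgesE : edges (@dutch_windmill n m) = [set e p | p in predT].
  apply/setP => A; apply/imset2P/imsetP.
    case=> x y _; rewrite inE => /andP[_ /andP[same adj]] ->.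
    have [i [xi yi]] : exists i, x = vtx i (windmill_pos x) /\
                                 y = vtx i (windmill_pos y).
      case: x y same adj => [[i j]|] [[i' j']|].
      - by move=> /eqP <- _; exists i; split; apply: vtx_pos.
      - by exists i; split; apply: vtx_pos.
      - by exists i'; split; apply: vtx_pos.
      - by rewrite /cycle_adj /= modn_small //; lia.
    case/orP: adj => /eqP pos_eq.
      exists (i, Ordinal (lt_pos x)) => //.
      by rewrite /e /= -pos_eq -xi -yi.
    exists (i, Ordinal (lt_pos y)) => //.
    by rewrite /e /= -pos_eq -xi -yi setUC.
  case=> -[i k] _ ->; exists (vtx i k) (vtx i (k.+1 %% n)%N) => //.
  rewrite inE /dutch_windmill /cycle_adj !pos_vtx ?ltn_pmod // eqxx andbT /=.
  case: (nat_of_ord k) => [|k1]; case: (_ %% n)%N => [|k2] //=;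
    case: insub => [?|] //=; case: insub => [?|] //=; exact: eqxx.
exists lab; split.
- move=> v v' eq_l.
  have pi_labv w : pi (lab w) = nth 0 s (windmill_pos w).
    case: w => [[i j]|]; last exact: pi_a.
    by rewrite (@vtx_pos i (Some (i, j))) // pi_lab ?lt_pos // -vtx_pos.
  have /eqP := congr1 pi eq_l; rewrite !pi_labv nth_uniq ?sz ?card_Q ?lt_pos //.
  case: v v' eq_l => [[i j]|] [[i' j']|] //= eq_l.
  rewrite eqSS => /eqP/val_inj eq_j; move: eq_l; rewrite eq_j.
  by move/addrI/h_inj ->.
- rewrite edgesE => _ _ /imsetP[p _ ->] /imsetP[p' _ ->] /phi_inj -> //.
- apply/eqP; rewrite eqEcard subsetT cardsT card_G edgesE -imset_comp.
  by rewrite /= (card_imset _ phi_inj) card_prod !card_ord.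
Qed.

End Windmill.

(** * Explicit orderings *)

Lemma good_fun (G : finZmodType) (F : nat -> G) (n a b : nat) :
  (1 < a)%N -> (a < b)%N -> (b.+1 < n)%N -> #|G| = n ->
  (forall g, exists2 k, (k < n)%N & F k = g) ->
  (forall g, (exists2 k, (k.+1 < n)%N & F k + F k.+1 = g) \/
             F n.-1 + F 0%N = g) ->
  F a.-1 + F a = F b.-1 + F 0%N -> F b.-1 + F b = F n.-1 + F a.-1 ->
  good G.
Proof.
move=> a1 ab bn cG cov sums r1 r2.
pose seg m k := [seq F i | i <- iota m k].
have seg_cat m k k' : seg m (k + k')%N = seg m k ++ seg (m + k)%N k'.
  by rewrite /seg iotaD map_cat.
have last_seg m k : last 0 (seg m k.+1) = F (m + k)%N.
  by rewrite -addn1 seg_cat last_cat.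
have head_seg m k : (0 < k)%N -> head 0 (seg m k) = F m by case: k.
exists (seg 0%N a), (seg a (b - a)%N), (seg b (n - b)%N).
have -> : seg 0%N a ++ seg a (b - a)%N ++ seg b (n - b)%N = seg 0%N n.
  rewrite -{2}(add0n a) catA -seg_cat subnKC 1?ltnW // -{2}(add0n b) -seg_cat.
  by rewrite subnKC //; lia.
have nth_seg k : (k < n)%N -> nth 0 (seg 0%N n) k = F k.
  by move=> lt_k; rewrite (nth_map 0%N) ?size_iota // nth_iota.
have lastn m k : (0 < k)%N -> last 0 (seg m k) = F (m + k).-1.
  by case: k => // k _; rewrite last_seg addnS.
split.
- split; first by rewrite size_map size_iota.
    move=> g; have [k lt_k <-] := cov g; apply: map_f.
    by rewrite mem_iota.
  move=> g; case: (sums g) => [[k lt_k <-]|<-].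
    rewrite in_cons -!nth_seg ?mem_isum_nth ?orbT ?size_map ?size_iota //.
    exact: ltnW.
  have n_gt0 : (0 < n)%N by lia.
  by rewrite in_cons lastn // head_seg // add0n eqxx.
- by rewrite !size_map !size_iota; split; lia.
- by rewrite !lastn ?head_seg ?subnKC //; lia.
- by rewrite !lastn ?head_seg ?subnKC //; lia.
Qed.

Section Table.
Variables (G : finZmodType) (x1 x2 x3 : G) (d1 d2 d3 : nat).
Hypotheses (d1_gt0 : (0 < d1)%N) (d2_gt0 : (0 < d2)%N) (d3_gt0 : (0 < d3)%N).
Hypotheses (x1_d : x1 *+ d1 = 0) (x2_d : x2 *+ d2 = 0) (x3_d : x3 *+ d3 = 0).
Hypothesis gen : forall g, exists i j k, g = x1 *+ i + x2 *+ j + x3 *+ k.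
Hypothesis card_G : #|G| = (d1 * d2 * d3)%N.

Definition combination (p : nat * nat * nat) : G :=
  x1 *+ p.1.1 + x2 *+ p.1.2 + x3 *+ p.2.

Lemma combinationD p q : combination (p + q) = combination p + combination q.
Proof.
rewrite /combination /= !mulrnDr [RHS]addrACA; congr (_ + _).
exact: addrACA.
Qed.

(** In the infinite families [d3] is [2 * s] with [s] a variable, so a reduction modulo [d3] would
    not be linear. As the coordinates are below [d3], sums of two of them that agree modulo [d3]
    differ by at most one [d3]. *)
Definition table_eq (p q : nat * nat * nat) : bool :=
  [&& p.1.1 == q.1.1 %[mod d1], p.1.2 == q.1.2 %[mod d2]
    & [|| p.2 == q.2, p.2 == q.2 + d3 | q.2 == p.2 + d3]]%N.

Lemma mulrn_modn (x : G) d k : x *+ d = 0 -> x *+ (k %% d) = x *+ k.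
Proof.
by move=> xd; rewrite [in RHS](divn_eq k d) mulrnDr mulnC mulrnA xd mul0rn add0r.
Qed.

Lemma table_eq_combination p q : table_eq p q -> combination p = combination q.
Proof.
case/and3P=> /eqP e1 /eqP e2 e3; rewrite /combination.
rewrite -(mulrn_modn p.1.1 x1_d) e1 mulrn_modn //.
rewrite -(mulrn_modn p.1.2 x2_d) e2 mulrn_modn //; congr (_ + _).
by case/or3P: e3 => /eqP ->; rewrite ?mulrnDr ?x3_d ?addr0.
Qed.

Lemma good_table (P : nat -> nat * nat * nat) (a b : nat) :
  let n := (d1 * d2 * d3)%N in
  (1 < a)%N -> (a < b)%N -> (b.+1 < n)%N ->
  (forall i j k, i < d1 -> j < d2 -> k < d3 ->
    exists2 r, r < n & table_eq (P r) (i, j, k))%N ->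
  (forall i j k, i < d1 -> j < d2 -> k < d3 ->
    (exists2 r, r.+1 < n & table_eq (P r + P r.+1)%R (i, j, k)) \/
    table_eq (P n.-1 + P 0)%R (i, j, k))%N ->
  table_eq (P a.-1 + P a) (P b.-1 + P 0%N) ->
  table_eq (P b.-1 + P b) (P n.-1 + P a.-1) ->
  good G.
Proof.
move=> n a1 ab bn cov sums r1 r2.
have genmod g : exists i j k,
    [/\ (i < d1)%N, (j < d2)%N, (k < d3)%N & g = combination (i, j, k)].
  have [i [j [k ->]]] := gen g.
  exists (i %% d1)%N, (j %% d2)%N, (k %% d3)%N; rewrite !ltn_pmod //; split=> //.
  by rewrite /combination /= !mulrn_modn.
apply: (@good_fun G (combination \o P) n a b) => //=.
- move=> g; have [i [j [k [id jd kd ->]]]] := genmod g.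
  have [r rn /table_eq_combination e] := cov i j k id jd kd.
  by exists r.
- move=> g; have [i [j [k [id jd kd ->]]]] := genmod g.
  case: (sums i j k id jd kd) => [[r rn /table_eq_combination e]|/table_eq_combination e].
    by left; exists r; rewrite // -combinationD.
  by right; rewrite -combinationD.
- by rewrite -!combinationD; apply: table_eq_combination.
- by rewrite -!combinationD; apply: table_eq_combination.
Qed.

(** For explicit lists: with numerals for [d1], [d2], [d3] it is decided by computation. *)
Definition table_check (l : seq (nat * nat * nat)) (a b : nat) : bool :=
  let n := (d1 * d2 * d3)%N in let P := nth (0, 0, 0)%N l in
  [&& (1 < a)%N, (a < b)%N, (b.+1 < n)%N,
   all (fun i => all (fun j => all (fun k =>
     has (fun r => table_eq (P r) (i, j, k)) (iota 0 n) &&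
     (has (fun r => table_eq (P r + P r.+1) (i, j, k)) (iota 0 n.-1) ||
       table_eq (P n.-1 + P 0%N) (i, j, k)))
     (iota 0 d3)) (iota 0 d2)) (iota 0 d1),
   table_eq (P a.-1 + P a) (P b.-1 + P 0%N) &
   table_eq (P b.-1 + P b) (P n.-1 + P a.-1)].

Lemma good_table_check l a b : table_check l a b -> good G.
Proof.
case/and5P=> a1 ab bn cov /andP[r1 r2].
set n := (d1 * d2 * d3)%N in bn cov r1 r2.
have covP i j k : (i < d1 -> j < d2 -> k < d3 ->
    has (fun r => table_eq (nth (0,0,0) l r) (i, j, k)) (iota 0 n) &&
    (has (fun r => table_eq (nth (0,0,0)%N l r + nth (0,0,0)%N l r.+1)%R (i, j, k))
       (iota 0 n.-1) ||
      table_eq (nth (0,0,0)%N l n.-1 + nth (0,0,0)%N l 0%N)%R (i, j, k)))%N.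
  move=> id jd kd; move/allP/(_ i): cov; rewrite mem_iota => /(_ id).
  move/allP/(_ j); rewrite mem_iota => /(_ jd).
  by move/allP/(_ k); rewrite mem_iota => /(_ kd).
apply: (@good_table (nth (0,0,0)%N l) a b) => //.
- move=> i j k id jd kd; have /andP[/hasP[r] + e _] := covP i j k id jd kd.
  by rewrite mem_iota => rn; exists r.
- move=> i j k id jd kd; have /andP[_ /orP[/hasP[r] + e|e]] := covP i j k id jd kd.
    by rewrite mem_iota => rn; left; exists r => //; rewrite -/n; lia.
  by right.
Qed.

End Table.

(* Ordering of Z_2 x Z_2s (the first coordinate is unused).  In the class 0 it runs
   through the even numbers below [s] upwards and the odd ones downwards, in the
   class 1 through the numbers below [s] upwards, and it alternates between the
   classes on the numbers above [s]; the irregular terms repair the ends. *)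
Definition fam1 (s k : nat) : nat * nat * nat :=
  (if k < (s.-1)./2 then (0, 0, 2 * k + 2)
  else if k < s - 1 then (0, 0, 2 * (s - 1 - k) - 1)
  else if k < 2 * s - 4 then (0, 1, k - (s - 1) + 2)
  else if k == 2 * s - 4 then (0, 1, s)
  else if k == 2 * s - 3 then (0, 1, s - 1)
  else if k == 2 * s - 2 then (0, 0, s)
  else if k == 2 * s - 1 then (0, 1, s + 1)
  else if k == 2 * s then (0, 0, s + 1)
  else if k < 4 * s - 3 then
    (0, odd (k - (2 * s + 1)) : nat, s + 2 + (k - (2 * s + 1))./2)
  else if k == 4 * s - 3 then (0, 1, 1)
  else if k == 4 * s - 2 then (0, 1, 0)
  else (0, 0, 0))%N.

Ltac split_ifs := repeat (case: ifP => ?; try by lia);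
  try by [lia | congr (_, _, _); lia].

Ltac table_lia := rewrite /table_eq /=; lia.

Section Fam1.
Variables (s : nat).
Hypothesis s_ge4 : (4 <= s)%N.
Let P := fam1 s.

Lemma fam1_even t : (t < (s.-1)./2)%N -> P t = (0, 0, 2 * t + 2)%N.
Proof. by move=> lt_t; rewrite /P /fam1; split_ifs. Qed.
Lemma fam1_odd t : (t < s./2)%N -> P (s - 2 - t) = (0, 0, 2 * t + 1)%N.
Proof. by move=> lt_t; rewrite /P /fam1; split_ifs. Qed.
Lemma fam1_path t : (t < s - 3)%N -> P (s - 1 + t)%N = (0, 1, t + 2)%N.
Proof. by move=> lt_t; rewrite /P /fam1; split_ifs. Qed.
Lemma fam1_zig0 t : (t < s - 2)%N -> P (2 * s + 1 + 2 * t)%N = (0, 0, s + 2 + t)%N.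
Proof. by move=> lt_t; rewrite /P /fam1; split_ifs. Qed.
Lemma fam1_zig1 t : (t < s - 2)%N -> P (2 * s + 1 + 2 * t).+1 = (0, 1, s + 2 + t)%N.
Proof. by move=> lt_t; rewrite /P /fam1; split_ifs. Qed.
Lemma fam1_mid : [/\ P (2 * s - 4) = (0, 1, s), P (2 * s - 3) = (0, 1, s - 1),
  P (2 * s - 2) = (0, 0, s), P (2 * s - 1) = (0, 1, s + 1) & P (2 * s) = (0, 0, s + 1)]%N.
Proof. by split; rewrite /P /fam1; split_ifs. Qed.
Lemma fam1_end : [/\ P (4 * s - 3) = (0, 1, 1), P (4 * s - 2) = (0, 1, 0)
  & P (4 * s - 1) = (0, 0, 0)]%N.
Proof. by split; rewrite /P /fam1; split_ifs. Qed.

(** In class 0 the ascending even numbers give the sums [4 * t + 6], the descending odd ones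
    [4 * t + 4], and the path in class 1 gives odd sums in class 0; the alternating stretch gives
    class 1. The few remaining sums come from the junctions and the irregular terms. *)
Lemma good_fam1_large (G : finZmodType) (u x : G) :
  u *+ 2 = 0 -> x *+ (2 * s) = 0 ->
  (forall g, exists j k, g = u *+ j + x *+ k) -> #|G| = (2 * (2 * s))%N ->
  good G.
Proof.
move=> u2 xs gen cG.
have [m1 m2 m3 m4 m5] := fam1_mid; have [e1 e2 e3] := fam1_end.
apply: (@good_table G 0 u x 1 2 (2 * s)%N _ _ _ _ u2 xs _ _ P (s - 1)%N (4 * s - 2)%N);
  rewrite ?mulr1n ?mul1n //; try lia.
- by move=> g; have [j [k ->]] := gen g; exists 0%N, j, k; rewrite mulr0n add0r.
- move=> i j k; rewrite ltnS leqn0 => /eqP -> j2 k2.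
  have use r p : P r = p -> (r < 4 * s)%N ->
      table_eq 1 2 (2 * s) p (0, j, k)%N ->
      exists2 r, (r < 2 * (2 * s))%N & table_eq 1 2 (2 * s) (P r) (0, j, k)%N.
    by move=> <- rs e; exists r => //; lia.
  case: j j2 use => [|[|//]] _ use.
  + have [|] := leqP s.+2 k => ks.
      by apply: (use _ _ (@fam1_zig0 (k - s - 2) _)); table_lia.
    have [k_eq|k0] := eqVneq k 0%N; first by apply: (use _ _ e3); table_lia.
    have [k_eq|k_s] := eqVneq k s; first by apply: (use _ _ m3); table_lia.
    have [k_eq|k_s1] := eqVneq k s.+1; first by apply: (use _ _ m5); table_lia.
    case: (boolP (odd k)) => ok.
      by apply: (use _ _ (@fam1_odd k./2 _)); table_lia.
    by apply: (use _ _ (@fam1_even (k./2).-1 _)); table_lia.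
  + have [|] := leqP s.+2 k => ks.
      by apply: (use _ _ (@fam1_zig1 (k - s - 2) _)); table_lia.
    have [k_eq|k0] := eqVneq k 0%N; first by apply: (use _ _ e2); table_lia.
    have [k_eq|k1] := eqVneq k 1%N; first by apply: (use _ _ e1); table_lia.
    have [k_eq|k_s] := eqVneq k s; first by apply: (use _ _ m1); table_lia.
    have [k_eq|k_s1] := eqVneq k s.+1; first by apply: (use _ _ m4); table_lia.
    have [k_eq|k_s2] := eqVneq k s.-1; first by apply: (use _ _ m2); table_lia.
    by apply: (use _ _ (@fam1_path (k - 2) _)); table_lia.
- move=> i j k; rewrite ltnS leqn0 => /eqP -> j2 k2.
  have use r r' p q : P r = p -> P r' = q -> r' = r.+1 -> (r.+1 < 4 * s)%N ->
      table_eq 1 2 (2 * s) (p + q) (0, j, k)%N ->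
      (exists2 r, (r.+1 < 2 * (2 * s))%N & table_eq 1 2 (2 * s) (P r + P r.+1) (0, j, k)%N)
      \/ table_eq 1 2 (2 * s) (P (2 * (2 * s)).-1 + P 0%N) (0, j, k)%N.
    by move=> <- <- -> rs e; left; exists r => //; lia.
  case: j j2 use => [|[|//]] _ use.
  + have [k_eq|k0] := eqVneq k 0%N.
      by apply: (use _ _ _ _ (@fam1_zig1 (s - 3) _) e1); table_lia.
    have [k_eq|k1] := eqVneq k 1%N.
      by apply: (use _ _ _ _ e1 e2); table_lia.
    have [k_eq|k_2] := eqVneq k 2.
      right; rewrite (_ : (2 * (2 * s)).-1 = 4 * s - 1)%N; last by lia.
      by rewrite e3 (@fam1_even 0) // /table_eq /=; lia.
    have [k_eq|k3] := eqVneq k 3.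
      by apply: (use _ _ _ _ m5 (@fam1_zig0 0 _)); table_lia.
    have [k_eq|ks2] := eqVneq k (2 * s - 2)%N.
      by apply: (use _ _ _ _ (@fam1_path (s - 4) _) m1); table_lia.
    have [k_eq|ks3] := eqVneq k (2 * s - 3)%N.
      by apply: (use _ _ _ _ (@fam1_even (s.-1./2.-1) _) (@fam1_odd (s./2.-1) _));
         table_lia.
    have [k_eq|ks1] := eqVneq k (2 * s - 1)%N.
      by apply: (use _ _ _ _ m1 m2); table_lia.
    case: (boolP (odd k)) => ok.
      by apply: (use _ _ _ _ (@fam1_path ((k - 5)./2) _) (@fam1_path ((k - 5)./2).+1 _));
         table_lia.
    case: (boolP (odd k./2)) => ok2.
      by apply: (use _ _ _ _ (@fam1_even ((k - 6)./2./2) _)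
                             (@fam1_even ((k - 6)./2./2).+1 _));
         table_lia.
    by apply: (use _ _ _ _ (@fam1_odd ((k - 4)./2./2).+1 _) (@fam1_odd ((k - 4)./2./2) _));
         table_lia.
  + have [k_eq|k0] := eqVneq k 0%N.
      by apply: (use _ _ _ _ e2 e3); table_lia.
    have [k_eq|k1] := eqVneq k 1%N.
      by apply: (use _ _ _ _ m3 m4); table_lia.
    have [k_eq|k_2] := eqVneq k 2.
      by apply: (use _ _ _ _ m4 m5); table_lia.
    have [k_eq|k3] := eqVneq k 3.
      by apply: (use _ _ _ _ (@fam1_odd 0 _) (@fam1_path 0 _)); table_lia.
    have [k_eq|ks1] := eqVneq k (2 * s - 1)%N.
      by apply: (use _ _ _ _ m2 m3); table_lia.
    case: (boolP (odd k)) => ok.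
      by apply: (use _ _ _ _ (@fam1_zig1 ((k - 5)./2) _) (@fam1_zig0 ((k - 5)./2).+1 _));
         table_lia.
    by apply: (use _ _ _ _ (@fam1_zig0 ((k - 4)./2) _) (@fam1_zig1 ((k - 4)./2) _));
         table_lia.
- have -> : P (s - 1).-1 = (0, 0, 1)%N by rewrite -(@fam1_odd 0) //; [congr P; lia|lia].
  have -> : P (s - 1)%N = (0, 1, 2)%N by rewrite -[(s - 1)%N]addn0 (@fam1_path 0) //; lia.
  have -> : P (4 * s - 2).-1 = (0, 1, 1)%N by rewrite -e1; congr P; lia.
  by rewrite (@fam1_even 0) // /table_eq /=; lia.
- have -> : P (s - 1).-1 = (0, 0, 1)%N by rewrite -(@fam1_odd 0) //; [congr P; lia|lia].
  have -> : P (4 * s - 2).-1 = (0, 1, 1)%N by rewrite -e1; congr P; lia.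
  have -> : P (2 * (2 * s)).-1 = (0, 0, 0)%N by rewrite -e3; congr P; lia.
  by rewrite e2 /table_eq /=; lia.
Qed.

End Fam1.

(* Ordering of Z_2 x Z_2 x Z_2s.  The class (0, 0) is traversed upwards below [s],
   then in steps of two up and down again; the other three classes are traversed
   by alternating between two of them, using half of each for either pair. *)
Definition fam2 (s k : nat) : nat * nat * nat :=
  (if k < 2 * s - 2 then
    (odd k : nat, 1, if odd k then k./2.+1 else s + 1 + k./2)
  else if k == 2 * s - 2 then (1, 0, s)
  else if k < 3 * s - 3 then (0, 0, k - (2 * s - 2))
  else if k < 3 * s - 3 + uphalf s then (0, 0, s + 2 * (k - (3 * s - 3)))
  else if k < 4 * s - 2 then (0, 0, s - 1 + 2 * (4 * s - 3 - k))
  else if k == 4 * s - 2 then (1, 0, 0)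
  else if k == 4 * s - 1 then (1, 1, 0)
  else if k == 4 * s then (0, 0, 0)
  else if k < 6 * s - 1 then
    (1, ~~ odd (k - (4 * s + 1)) : nat, 2 * s - 1 - (k - (4 * s + 1))./2)
  else if k == 6 * s - 1 then (1, 1, s)
  else if k == 6 * s then (0, 1, 0)
  else if k < 8 * s - 1 then
    (~~ odd (k - (6 * s + 1)) : nat, odd (k - (6 * s + 1)) : nat,
     (k - (6 * s + 1))./2.+1)
  else (0, 1, s))%N.

Section Fam2.
Variable s : nat.
Hypothesis s_ge3 : (3 <= s)%N.
Let P := fam2 s.

Lemma fam2_b0 t : (t < s - 1)%N -> P (2 * t)%N = (0, 1, s + 1 + t)%N.
Proof. by move=> lt_t; rewrite /P /fam2; split_ifs. Qed.
Lemma fam2_c0 t : (t < s - 1)%N -> P (2 * t).+1 = (1, 1, t.+1)%N.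
Proof. by move=> lt_t; rewrite /P /fam2; split_ifs. Qed.
Lemma fam2_path t : (t < s - 2)%N -> P (2 * s - 1 + t)%N = (0, 0, t.+1)%N.
Proof. by move=> lt_t; rewrite /P /fam2; split_ifs. Qed.
Lemma fam2_up t : (t < uphalf s)%N -> P (3 * s - 3 + t)%N = (0, 0, s + 2 * t)%N.
Proof. by move=> lt_t; rewrite /P /fam2; split_ifs. Qed.
Lemma fam2_down t : (t <= s./2)%N -> P (4 * s - 3 - t)%N = (0, 0, s - 1 + 2 * t)%N.
Proof. by move=> lt_t; rewrite /P /fam2; split_ifs. Qed.
Lemma fam2_c1 t : (t < s - 1)%N -> P (4 * s + 1 + 2 * t)%N = (1, 1, 2 * s - 1 - t)%N.
Proof. by move=> lt_t; rewrite /P /fam2; split_ifs. Qed.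
Lemma fam2_a1 t : (t < s - 1)%N -> P (4 * s + 1 + 2 * t).+1 = (1, 0, 2 * s - 1 - t)%N.
Proof. by move=> lt_t; rewrite /P /fam2; split_ifs. Qed.
Lemma fam2_a2 t : (t < s - 1)%N -> P (6 * s + 1 + 2 * t)%N = (1, 0, t.+1)%N.
Proof. by move=> lt_t; rewrite /P /fam2; split_ifs. Qed.
Lemma fam2_b2 t : (t < s - 1)%N -> P (6 * s + 1 + 2 * t).+1 = (0, 1, t.+1)%N.
Proof. by move=> lt_t; rewrite /P /fam2; split_ifs. Qed.
Lemma fam2_turn : [/\ P (2 * s - 2) = (1, 0, s), P (4 * s - 2) = (1, 0, 0),
  P (4 * s - 1) = (1, 1, 0) & P (4 * s) = (0, 0, 0)]%N.
Proof. by split; rewrite /P /fam2; split_ifs. Qed.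
Lemma fam2_end : [/\ P (6 * s - 1) = (1, 1, s), P (6 * s) = (0, 1, 0)
  & P (8 * s - 1) = (0, 1, s)]%N.
Proof. by split; rewrite /P /fam2; split_ifs. Qed.

(** Alternating between two nonzero classes produces sums in the third, so the three pairs serve the
    three nonzero classes. In class (0, 0), steps of one give the odd sums; modulo [2 * s], steps of
    two give [4 * t + 2] on the way up and [4 * t] on the way down. *)
Lemma good_fam2_large (G : finZmodType) (u v x : G) :
  u *+ 2 = 0 -> v *+ 2 = 0 -> x *+ (2 * s) = 0 ->
  (forall g, exists i j k, g = u *+ i + v *+ j + x *+ k) ->
  #|G| = (2 * 2 * (2 * s))%N -> good G.
Proof.
move=> u2 v2 xs gen cG.
have [a_s a_0 c_0 z_0] := fam2_turn; have [c_s b_0 b_s] := fam2_end.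
have posE r r' p : P r = p -> r = r' -> P r' = p by move=> + <-.
apply: (@good_table G u v x 2 2 (2 * s)%N _ _ _ u2 v2 xs gen cG P
          (2 * s - 1)%N (4 * s)%N); try lia.
- move=> i j k i2 j2 k2.
  have use r p : P r = p -> (r < 8 * s)%N ->
      table_eq 2 2 (2 * s) p (i, j, k)%N ->
      exists2 r, (r < 2 * 2 * (2 * s))%N & table_eq 2 2 (2 * s) (P r) (i, j, k)%N.
    by move=> <- rs e; exists r => //; lia.
  case: i i2 use => [|[|//]] _; case: j j2 => [|[|//]] _ use.
  + have [?|?] := eqVneq k 0%N.
      by apply: (use _ _ z_0); table_lia.
    have [|] := leqP k (s - 2)%N => ?.
      by apply: (use _ _ (@fam2_path (k - 1) _)); table_lia.
    case: (boolP (odd (k - s))) => ?.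
      by apply: (use _ _ (@fam2_down ((k - s + 1)./2) _)); table_lia.
    have [?|?] := eqVneq k (s - 1)%N.
      by apply: (use _ _ (@fam2_down 0 _)); table_lia.
    by apply: (use _ _ (@fam2_up ((k - s)./2) _)); table_lia.
  + have [?|?] := eqVneq k 0%N.
      by apply: (use _ _ b_0); table_lia.
    have [?|?] := eqVneq k s.
      by apply: (use _ _ b_s); table_lia.
    have [|] := leqP s (k)%N => ?.
      by apply: (use _ _ (@fam2_b0 (k - s - 1) _)); table_lia.
    by apply: (use _ _ (@fam2_b2 (k - 1) _)); table_lia.
  + have [?|?] := eqVneq k 0%N.
      by apply: (use _ _ a_0); table_lia.
    have [?|?] := eqVneq k s.
      by apply: (use _ _ a_s); table_lia.
    have [|] := leqP s (k)%N => ?.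
      by apply: (use _ _ (@fam2_a1 (2 * s - 1 - k) _)); table_lia.
    by apply: (use _ _ (@fam2_a2 (k - 1) _)); table_lia.
  + have [?|?] := eqVneq k 0%N.
      by apply: (use _ _ c_0); table_lia.
    have [?|?] := eqVneq k s.
      by apply: (use _ _ c_s); table_lia.
    have [|] := leqP s (k)%N => ?.
      by apply: (use _ _ (@fam2_c1 (2 * s - 1 - k) _)); table_lia.
    by apply: (use _ _ (@fam2_c0 (k - 1) _)); table_lia.
- move=> i j k i2 j2 k2.
  have use r r' p q : P r = p -> P r' = q -> r' = r.+1 -> (r.+1 < 8 * s)%N ->
      table_eq 2 2 (2 * s) (p + q) (i, j, k)%N ->
      (exists2 r, (r.+1 < 2 * 2 * (2 * s))%N &
         table_eq 2 2 (2 * s) (P r + P r.+1) (i, j, k)%N)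
      \/ table_eq 2 2 (2 * s) (P (2 * 2 * (2 * s)).-1 + P 0%N) (i, j, k)%N.
    by move=> <- <- -> rs e; left; exists r => //; lia.
  case: i i2 use => [|[|//]] _; case: j j2 => [|[|//]] _ use.
  + have [?|?] := eqVneq k 1%N.
      right; rewrite (posE _ _ _ b_s) ?(posE _ _ _ (@fam2_b0 0 _)) /table_eq //=; lia.
    have [?|?] := eqVneq k (2 * s - 1)%N.
      by apply: (use _ _ _ _ (@fam2_b2 (s - 2) _) b_s); table_lia.
    have [?|?] := eqVneq k (2 * s - 2)%N.
      by apply: (use _ _ _ _ (@fam2_path (s - 3) _) (@fam2_up 0 _)); table_lia.
    have [?|?] := eqVneq k (2 * s - 3)%N.
      by apply: (use _ _ _ _ (@fam2_up ((uphalf s).-1) _)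
                    (@fam2_down (s./2) _)); table_lia.
    case: (boolP (odd k)) => ?.
      by apply: (use _ _ _ _ (@fam2_path ((k - 3)./2) _)
                    (@fam2_path ((k - 3)./2.+1) _)); table_lia.
    case: (boolP (odd k./2)) => ?.
      by apply: (use _ _ _ _ (@fam2_up (k./2./2) _)
                    (@fam2_up (k./2./2.+1) _)); table_lia.
    by apply: (use _ _ _ _ (@fam2_down (k./2./2.+1) _)
                  (@fam2_down (k./2./2) _)); table_lia.
  + have [?|?] := eqVneq k 0%N.
      by apply: (use _ _ _ _ a_0 c_0); table_lia.
    have [?|?] := eqVneq k (2 * s - 1)%N.
      by apply: (use _ _ _ _ (@fam2_c0 (s - 2) _) a_s); table_lia.
    have [?|?] := eqVneq k 1%N.
      by apply: (use _ _ _ _ (@fam2_a1 (s - 2) _) c_s); table_lia.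
    case: (boolP (odd k)) => ?.
      by apply: (use _ _ _ _ (@fam2_a1 ((2 * s - 3 - k)./2) _)
                    (@fam2_c1 ((2 * s - 3 - k)./2.+1) _)); table_lia.
    by apply: (use _ _ _ _ (@fam2_c1 ((2 * s - 2 - k)./2) _)
                  (@fam2_a1 ((2 * s - 2 - k)./2) _)); table_lia.
  + have [?|?] := eqVneq k s.
      by apply: (use _ _ _ _ c_s b_0); table_lia.
    have [?|?] := eqVneq k (s + 1)%N.
      by apply: (use _ _ _ _ a_s (@fam2_path 0 _)); table_lia.
    have [?|?] := eqVneq k (s - 1)%N.
      by apply: (use _ _ _ _ (@fam2_down 0 _) a_0); table_lia.
    (* The sums in this class start at [s + 2] and wrap round at [2 * s], hence the split at [s]. *)
    have [|] := leqP s (k)%N => ?.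
      case: (boolP (odd (k - s))) => ?.
        by apply: (use _ _ _ _ (@fam2_c0 ((k - s - 3)./2) _)
                      (@fam2_b0 ((k - s - 3)./2.+1) _)); table_lia.
      by apply: (use _ _ _ _ (@fam2_b0 ((k - s - 2)./2) _)
                    (@fam2_c0 ((k - s - 2)./2) _)); table_lia.
    case: (boolP (odd (k + s))) => ?.
      by apply: (use _ _ _ _ (@fam2_c0 ((k + s - 3)./2) _)
                    (@fam2_b0 ((k + s - 3)./2.+1) _)); table_lia.
    by apply: (use _ _ _ _ (@fam2_b0 ((k + s - 2)./2) _)
                  (@fam2_c0 ((k + s - 2)./2) _)); table_lia.
  + have [?|?] := eqVneq k 0%N.
      by apply: (use _ _ _ _ c_0 z_0); table_lia.
    have [?|?] := eqVneq k (2 * s - 1)%N.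
      by apply: (use _ _ _ _ z_0 (@fam2_c1 0 _)); table_lia.
    have [?|?] := eqVneq k 1%N.
      by apply: (use _ _ _ _ b_0 (@fam2_a2 0 _)); table_lia.
    case: (boolP (odd k)) => ?.
      by apply: (use _ _ _ _ (@fam2_b2 ((k - 3)./2) _)
                    (@fam2_a2 ((k - 3)./2.+1) _)); table_lia.
    by apply: (use _ _ _ _ (@fam2_a2 ((k - 2)./2) _)
                  (@fam2_b2 ((k - 2)./2) _)); table_lia.
- rewrite (@posE _ (2 * s - 1).-1 _ a_s); last by lia.
  rewrite (@posE _ (2 * s - 1) _ (@fam2_path 0 _))%N; [|by lia..].
  rewrite (@posE _ (4 * s).-1 _ c_0); last by lia.
  by rewrite (@posE _ 0%N _ (@fam2_b0 0 _)) /table_eq //=; lia.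
- rewrite (@posE _ (2 * s - 1).-1 _ a_s); last by lia.
  rewrite (@posE _ (4 * s).-1 _ c_0); last by lia.
  rewrite (@posE _ (2 * 2 * (2 * s)).-1 _ b_s); last by lia.
  by rewrite z_0 /table_eq /=; lia.
Qed.

End Fam2.

(** * The three explicit types, including their small cases *)

Lemma good_rank2 (G : finZmodType) (u x : G) (s : nat) : (2 <= s)%N ->
  u *+ 2 = 0 -> x *+ (2 * s) = 0 ->
  (forall g, exists j k, g = u *+ j + x *+ k) -> #|G| = (2 * (2 * s))%N ->
  good G.
Proof.
move=> s2 u2 xs gen cG.
case: (leqP 4 s) => s4; first exact: (good_fam1_large s4 u2 xs gen cG).
have gen' g : exists i j k, g = (0 : G) *+ i + u *+ j + x *+ k.
  by have [j [k ->]] := gen g; exists 0%N, j, k; rewrite mulr0n add0r.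
have [s_eq|s_eq] : s = 2 \/ s = 3 by lia.
  subst s; apply: (@good_table_check G 0 u x 1 2 4 _ _ _ _ u2 xs gen' cG
    [:: (0,1,3); (0,1,0); (0,1,1); (0,0,1); (0,0,3); (0,1,2);
        (0,0,2); (0,0,0)]%N 2 6) => //.
subst s; apply: (@good_table_check G 0 u x 1 2 6 _ _ _ _ u2 xs gen' cG
  [:: (0,1,2); (0,0,1); (0,0,3); (0,1,4); (0,1,1); (0,0,4); (0,0,2);
      (0,0,5); (0,1,5); (0,1,3); (0,1,0); (0,0,0)]%N 7 9) => //.
Qed.

Lemma good_rank3 (G : finZmodType) (u v x : G) (s : nat) : (2 <= s)%N ->
  u *+ 2 = 0 -> v *+ 2 = 0 -> x *+ (2 * s) = 0 ->
  (forall g, exists i j k, g = u *+ i + v *+ j + x *+ k) ->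
  #|G| = (2 * 2 * (2 * s))%N -> good G.
Proof.
move=> s2 u2 v2 xs gen cG.
case: (leqP 3 s) => s3; first exact: (good_fam2_large s3 u2 v2 xs gen cG).
have s_eq : s = 2 by lia.
subst s; apply: (@good_table_check G u v x 2 2 4 _ _ _ u2 v2 xs gen cG
  [:: (1,1,0); (1,1,2); (0,0,3); (0,0,2); (1,0,2); (0,1,1); (1,1,1); (1,0,1); (1,0,3);
      (1,0,0); (0,1,2); (1,1,3); (0,1,0); (0,0,1); (0,1,3); (0,0,0)]%N 9 12) => //.
Qed.

Lemma good_Z4Z4 (G : finZmodType) (x y : G) : x *+ 4 = 0 -> y *+ 4 = 0 ->
  (forall g, exists j k, g = x *+ j + y *+ k) -> #|G| = 16 -> good G.
Proof.
move=> x4 y4 gen cG.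
have gen' g : exists i j k, g = (0 : G) *+ i + x *+ j + y *+ k.
  by have [j [k ->]] := gen g; exists 0%N, j, k; rewrite mulr0n add0r.
apply: (@good_table_check G 0 x y 1 4 4 _ _ _ _ x4 y4 gen' cG
  [:: (0,3,1); (0,0,2); (0,1,0); (0,1,1); (0,3,2); (0,1,3); (0,0,1); (0,2,1); (0,2,3);
      (0,1,2); (0,0,3); (0,3,3); (0,3,0); (0,0,0); (0,2,0); (0,2,2)]%N 6 9) => //.
Qed.

(** * Quotients and the induction *)

(** The induction runs on additive groups while [coset_of H] is multiplicative. The translation
    [phi] is returned too, in order to transport a subgroup given inside [coset_of H]. *)
Lemma quotient_zmod (G : finZmodType) (H : {group G}) :
  exists (Q : finZmodType) (pi : {additive G -> Q}) (phi : coset_of H -> Q),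
  [/\ forall q, exists g, pi g = q, forall g, (pi g == 0) = (g \in H),
      #|G| = (#|H| * #|Q|)%N, injective phi
    & {morph phi : a b / (a * b)%g >-> a + b}].
Proof.
have abG (A : {set G}) : abelian A by exact: FinRing.zmod_abelian.
have nH x : x \in 'N(H)%g.
  by apply: (subsetP (sub_abelian_norm (abG [set: G]) (subsetT H))).
have allQ (a : coset_of H) : a \in ([set: G] / H)%g.
  by have [x nx ->] := cosetP a; apply: mem_quotient.
have abQ : abelian ([set: G] / H)%g := quotient_abelian _ (abG _).
pose phi : coset_of H -> FiniteModule.fmod_of abQ := FiniteModule.fmod abQ.
have phiM : {morph phi : a b / (a * b)%g >-> a + b}.
  by move=> a b; apply: FiniteModule.fmodM.
have phi_inj : injective phi.
  by move=> a b eq_ab; apply: (injmP (FiniteModule.injm_fmod abQ)).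
pose f0 (x : G) := phi (coset H x).
have fB : zmod_morphism f0.
  move=> x y; apply: (addIr (f0 y)); rewrite subrK /f0 -phiM -morphM //.
  by rewrite [(_ * _)%g](subrK y x).
pose pi : {additive G -> FiniteModule.fmod_of abQ} :=
  HB.pack f0 (GRing.isZmodMorphism.Build G _ f0 fB).
exists (FiniteModule.fmod_of abQ), pi, phi; split=> //.
- move=> q; have [x _ xq] := cosetP (val q).
  by exists x; rewrite /= /f0 -xq /phi FiniteModule.fmvalK.
- move=> g; rewrite /= /f0 -(FiniteModule.fmod1 abQ) (inj_eq phi_inj).
  apply/eqP/idP => [|/coset_id //]; exact: coset_idr.
- have -> : #|{: FiniteModule.fmod_of abQ}| = #|([set: G] / H)%g|.
    exact: card_sub.
  rewrite card_quotient ?Lagrange ?subsetT ?cardsT //.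
  by apply/subsetP => x _.
Qed.

Section Reductions.
Variable G : finZmodType.
Implicit Types x y v t : G.

Definition two_torsion : {set G} := [set v | v *+ 2 == 0].

Lemma two_torsionP v : reflect (v *+ 2 = 0) (v \in two_torsion).
Proof. by rewrite inE; apply: eqP. Qed.

Lemma order_dvd_mulrn y k : (#[y]%g %| k)%N = (y *+ k == 0).
Proof. by rewrite order_dvdn. Qed.

Definition klein_seq t1 t2 : seq G := [:: 0; t1; t2; t1 + t2].

Lemma klein_seq_uniq t1 t2 : t1 *+ 2 = 0 -> t1 != 0 -> t2 != 0 -> t1 != t2 ->
  uniq (klein_seq t1 t2).
Proof.
move=> d1 n1 n2 n12; rewrite /= !inE !negb_or ![0 == _]eq_sym n1 n2 n12 /=.
rewrite -{2}[t1]addr0 (inj_eq (addrI _)) [0 == _]eq_sym n2 andbT.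
rewrite -{2}[t2]add0r (inj_eq (addIr _)) [0 == _]eq_sym n1 !andbT.
apply: contra n12 => /eqP s0; apply/eqP.
by apply: (addrI t1); rewrite s0 -mulr2n.
Qed.

Lemma klein_seqD t1 t2 a b : t1 *+ 2 = 0 -> t2 *+ 2 = 0 ->
  a \in klein_seq t1 t2 -> b \in klein_seq t1 t2 -> a + b \in klein_seq t1 t2.
Proof.
rewrite !mulr2n => e1 e2.
have e3 z : t1 + (t1 + z) = z by rewrite addrA e1 add0r.
have e4 z : t2 + (t2 + z) = z by rewrite addrA e2 add0r.
have e5 : t2 + t1 = t1 + t2 by rewrite addrC.
have e6 z : t2 + (t1 + z) = t1 + (t2 + z) by rewrite addrCA.
rewrite !inE => /or4P[] /eqP-> /or4P[] /eqP->;
by rewrite -?addrA ?(add0r, addr0, e1, e2, e3, e4, e5, e6)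
  ?(add0r, addr0, e1, e2, e3, e4) ?eqxx ?orbT.
Qed.

Lemma klein_group t1 t2 : t1 *+ 2 = 0 -> t2 *+ 2 = 0 ->
  group_set [set g | g \in klein_seq t1 t2].
Proof.
move=> d1 d2; apply/group_setP; split=> [|a b]; first by rewrite inE mem_head.
by rewrite 3!in_set; apply: klein_seqD.
Qed.

Lemma klein_quotient t1 t2 : t1 *+ 2 = 0 -> t2 *+ 2 = 0 ->
  t1 != 0 -> t2 != 0 -> t1 != t2 ->
  exists (Q : finZmodType) (pi : {additive G -> Q}),
  [/\ forall q, exists g, pi g = q,
      forall g, (pi g == 0) = (g \in klein_seq t1 t2),
      #|G| = (4 * #|Q|)%N & good Q -> good G].
Proof.
move=> d1 d2 n1 n2 n12; pose S := [set g | g \in klein_seq t1 t2].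
have gS : group_set S := klein_group d1 d2.
have [Q [pi [_ [surj ker cG _ _]]]] := quotient_zmod (Group gS).
have cS : #|S| = 4.
  rewrite (_ : 4 = size (klein_seq t1 t2)) // -(card_uniqP (klein_seq_uniq d1 n1 n2 n12)).
  by apply: eq_card => g; rewrite inE.
exists Q, pi; split=> //.
- by move=> g; rewrite ker inE.
- by rewrite cG /= cS.
- apply: (@good_klein G Q pi t1 t2); rewrite -?mulr2n //.
  + by apply/eqP; rewrite ker !inE eqxx orbT.
  + by apply/eqP; rewrite ker !inE eqxx !orbT.
  + by move=> g /eqP; rewrite ker inE.
  + by rewrite cG /= cS.
Qed.

Lemma odd_quotient y : odd #[y]%g ->
  exists (Q : finZmodType) (pi : {additive G -> Q}),
  [/\ forall q, exists g, pi g = q,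
      forall g, (pi g == 0) = (g \in <[y]>%g),
      #|G| = (#[y]%g * #|Q|)%N & good Q -> good G].
Proof.
move=> oy; have [Q [pi [_ [surj ker cG _ _]]]] := quotient_zmod <[y]>%G.
exists Q, pi; split=> //.
have o1 : (#[y]%g.-1).+1 = #[y]%g by rewrite prednK.
apply: (@good_odd_lift G Q pi y (#[y]%g.-1)) => //.
- by move: oy; rewrite -o1 /=.
- by rewrite o1; apply/eqP; rewrite -order_dvd_mulrn.
- by apply/eqP; rewrite ker cycle_id.
- by move=> g /eqP; rewrite ker => /cycleP[k ->]; exists k.
- by rewrite o1.
Qed.

Lemma pick_outside (A : {set G}) (l : seq G) : (size l < #|A|)%N ->
  exists2 v, v \in A & v \notin l.
Proof.
move=> lt_l; case: (pickP [pred v in A | v \notin l]) => [v /andP[]|no].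
  by exists v.
have: (#|A| <= size l)%N; last by rewrite leqNgt lt_l.
apply: leq_trans (card_size l); apply: subset_leq_card; apply/subsetP => v vA.
by have /= := no v; rewrite vA /=; case: (v \in l).
Qed.

Lemma two_torsion_group : group_set two_torsion.
Proof.
apply/group_setP; split=> [|a b]; first by rewrite inE FinRing.zmod1gE mul0rn.
by move=> /two_torsionP a2 /two_torsionP b2; apply/two_torsionP;
   rewrite FinRing.zmodMgE mulrnDl a2 b2 addr0.
Qed.

(** Modulo the 2-torsion, [G] is generated by the image of [x], whose order is [s] because [x *+ k]
    is 2-torsion exactly when [s] divides [k]. *)
Lemma card_two_torsion_cyclic x s : #[x]%g = (2 * s)%N ->
  (forall g, exists v k, v *+ 2 = 0 /\ g = v + x *+ k) ->
  #|G| = (#|two_torsion| * s)%N.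
Proof.
move=> ox gen.
have [Q [pi [_ [surj ker cG _ _]]]] := quotient_zmod (Group two_torsion_group).
rewrite cG /=; congr (_ * _)%N.
have <- : #[pi x]%g = s.
  apply/eqP; rewrite eqn_dvd; have ord k : (#[pi x]%g %| k)%N = (s %| k)%N.
    rewrite order_dvdn -[(_ ^+ k)%g]/(pi x *+ k) -raddfMn ker inE -mulrnA mulnC.
    by rewrite -order_dvd_mulrn ox dvdn_pmul2l.
  by apply/andP; split; [rewrite ord | rewrite -ord].
rewrite /order -cardsT; apply: eq_card => q; rewrite inE; apply/esym/cycleP.
have [g <-] := surj q; have [v [k [v2 ->]]] := gen g.
exists k; rewrite raddfD raddfMn; have /eqP -> : pi v == 0 by rewrite ker inE v2.
by rewrite add0r.
Qed.

Definition noncyclic2 := exists t1 t2,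
  [/\ t1 *+ 2 = 0, t2 *+ 2 = 0, t1 != 0, t2 != 0 & t1 != t2].

(** The involution [x *+ s] is completed to generators of the 2-torsion by one element if this has
    order 4, and by two if it has order 8; these are the types of rank 2 and 3. *)
Lemma good_cyclic_by_two_torsion x s : #[x]%g = (2 * s)%N -> (2 <= s)%N ->
  (forall g, exists v k, v *+ 2 = 0 /\ g = v + x *+ k) ->
  noncyclic2 -> (#|two_torsion| <= 8)%N -> good G.
Proof.
move=> ox s2 gen [t1 [t2 [d1 d2 n1 n2 n12]]] leV8.
have cG := card_two_torsion_cyclic ox gen.
have xs : x *+ (2 * s) = 0 by apply/eqP; rewrite -order_dvd_mulrn ox.
pose w := x *+ s.
have w2 : w *+ 2 = 0 by rewrite -mulrnA mulnC.
have w0 : w != 0.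
  rewrite -order_dvd_mulrn ox; apply/negP => /dvdn_leq; lia.
have [t [td t0 tw]] : exists t, [/\ t *+ 2 = 0, t != 0 & t != w].
  case: (eqVneq t1 w) => [t1w|]; last by exists t1.
  by exists t2; split=> //; rewrite -t1w eq_sym.
have u4 : uniq (klein_seq w t) by rewrite klein_seq_uniq // eq_sym.
have in4 g : g \in klein_seq w t -> exists a b, g = x *+ a + t *+ b.
  rewrite !inE => /or4P[] /eqP ->.
  - by exists 0%N, 0%N; rewrite !mulr0n addr0.
  - by exists s, 0%N; rewrite mulr0n addr0.
  - by exists 0%N, 1%N; rewrite mulr0n add0r.
  - by exists s, 1%N.
have sub4 g : g \in klein_seq w t -> g \in two_torsion.
  by rewrite !inE => /or4P[] /eqP ->; rewrite ?mulrnDl ?mul0rn ?w2 ?td ?addr0.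
case: (boolP [forall v in two_torsion, v \in klein_seq w t]) => [/forall_inP V4|].
  apply: (@good_rank2 G t x s) => //.
    move=> g; have [v [k [/two_torsionP/V4/in4[a [b ->]] ->]]] := gen g.
    by exists b, (a + k)%N; rewrite addrAC -mulrnDr addrC.
  rewrite cG (_ : #|two_torsion| = 4) 1?mulnA //.
  rewrite -[4]/(size (klein_seq w t)) -(card_uniqP u4); apply: eq_card => g.
  by apply/idP/idP; [apply: V4 | apply: sub4].
rewrite negb_forall_in => /exists_inP[v /two_torsionP v2 nv].
pose l := klein_seq w t ++ [seq v + g | g <- klein_seq w t].
have u8 : uniq l.
  rewrite cat_uniq u4 (map_inj_uniq (addrI v)) u4 andbT.
  apply/hasPn => _ /mapP[g g4 ->]; apply: contra nv => vg4.
  have -> : v = (v + g) + g.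
    by rewrite -addrA -mulr2n (two_torsionP _ (sub4 g g4)) addr0.
  exact: klein_seqD.
have sub8 g : g \in l -> g \in two_torsion.
  rewrite mem_cat => /orP[/sub4 //|/mapP[h /sub4/two_torsionP h2 ->]].
  by apply/two_torsionP; rewrite mulrnDl v2 h2 addr0.
have V8 : {subset two_torsion <= l}.
  have sub g : g \in l -> g \in enum two_torsion by rewrite mem_enum; apply: sub8.
  have [|_ eq_l] := uniq_min_size u8 sub; first by rewrite -cardE.
  by move=> g; rewrite -mem_enum -eq_l.
apply: (@good_rank3 G t v x s) => //.
- move=> g; have [v' [k [/two_torsionP/V8 v'l ->]]] := gen g.
  move: v'l; rewrite mem_cat => /orP[/in4[a [b ->]]|/mapP[h /in4[a [b ->]] ->]].
    by exists b, 0%N, (a + k)%N; rewrite mulr0n addr0 addrAC -mulrnDr addrC.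
  exists b, 1%N, (a + k)%N; rewrite mulr1n mulrnDr !addrA; congr (_ + _).
  by rewrite addrC addrA.
- rewrite cG (_ : #|two_torsion| = 8) 1?mulnA //.
  rewrite -[8]/(size l) -(card_uniqP u8); apply: eq_card => g.
  by apply/idP/idP; [apply: V8 | apply: sub8].
Qed.

End Reductions.

(** * The case analysis of the induction *)

Section Step.
Variable G : finZmodType.
Hypothesis IH : forall Q : finZmodType, (#|Q| < #|G|)%N ->
  noncyclic2 Q -> (exists z : Q, z *+ 2 != 0) -> good Q.

(** [r1] and [r2] map to two distinct involutions of the quotient and [z] to an element with nonzero
    double, so the induction hypothesis applies there. *)
Lemma klein_step (t1 t2 r1 r2 z : G) : t1 *+ 2 = 0 -> t2 *+ 2 = 0 ->
  t1 != 0 -> t2 != 0 -> t1 != t2 ->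
  r1 *+ 2 \in klein_seq t1 t2 -> r2 *+ 2 \in klein_seq t1 t2 ->
  r1 \notin klein_seq t1 t2 -> r2 \notin klein_seq t1 t2 ->
  r1 - r2 \notin klein_seq t1 t2 -> z *+ 2 \notin klein_seq t1 t2 -> good G.
Proof.
move=> d1 d2 n1 n2 n12 k1 k2 o1 o2 o12 oz.
have [Q [pi [surj ker cG lift]]] := klein_quotient d1 d2 n1 n2 n12.
apply/lift/IH.
- have : (0 < #|Q|)%N by apply/card_gt0P; exists 0.
  by rewrite cG; lia.
- have r12 : pi r1 != pi r2 by rewrite -subr_eq0 -raddfB ker.
  by exists (pi r1), (pi r2); split; rewrite -?raddfMn ?ker //; apply/eqP; rewrite ker.
- by exists (pi z); rewrite -raddfMn ker.
Qed.

Lemma good_step : noncyclic2 G -> (exists z : G, z *+ 2 != 0) -> good G.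
Proof.
move=> nc [z z2]; have [t1 [t2 [d1 d2 n1 n2 n12]]] := nc.
have oppV (a : G) : a *+ 2 = 0 -> - a = a.
  by move=> a2; apply: (addrI a); rewrite subrr -mulr2n a2.
(* With a large 2-torsion there is room for a Klein group [a], [b] that avoids [z *+ 2] and for two
   further involutions independent modulo it. The bound 8 is the number of elements excluded for
   [r2]. *)
have [V_large|V_small] := ltnP 8 #|two_torsion G|.
  have [a /two_torsionP a2] :=
    @pick_outside G _ [:: 0; z *+ 2] (ltn_trans (isT : 2 < 8)%N V_large).
  rewrite !inE negb_or => /andP[a0 az].
  have [b /two_torsionP b2] := @pick_outside G _ [:: 0; a; z *+ 2; z *+ 2 - a]
    (ltn_trans (isT : 4 < 8)%N V_large).
  rewrite !inE !negb_or => /and4P[b0 ba bz bza].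
  have [r1 /two_torsionP r12 r1n] := @pick_outside G _ (klein_seq a b)
    (ltn_trans (isT : 4 < 8)%N V_large).
  have [r2 /two_torsionP r22] := @pick_outside G _
    (klein_seq a b ++ [seq r1 + g | g <- klein_seq a b]) V_large.
  rewrite mem_cat negb_or => /andP[r2n r2m].
  apply: (@klein_step a b r1 r2 z) => //.
  - by rewrite eq_sym.
  - by rewrite r12 mem_head.
  - by rewrite r22 mem_head.
  - apply: contra r2m => r12n; apply/mapP; exists (r1 - r2) => //.
    by rewrite addrA -mulr2n r12 add0r oppV.
  - rewrite !inE !negb_or z2 ![z *+ 2 == _]eq_sym az bz /=.
    by apply: contra bza => /eqP <-; rewrite addrC addKr.
have [/existsP[y /andP[y0 oy]]|no_odd] := boolP [exists y : G, (y != 0) && odd #[y]%g].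
  (* If all doubles lie in [<[y]>], the quotient is an elementary 2-group and has no ordering. But
     then [G] is the sum of its 2-torsion and the cyclic group generated by [y + t1], an explicit
     type. *)
  have [gt2|le2] : (exists g : G, g *+ 2 \notin <[y]>%g) \/
                   (forall g : G, g *+ 2 \in <[y]>%g).
    case: (boolP [exists g : G, g *+ 2 \notin <[y]>%g]) => [/existsP|no]; first by left.
    right=> g; move: no; rewrite negb_exists => /forallP/(_ g).
    by rewrite negbK.
    have [Q [pi [surj ker cG lift]]] := odd_quotient oy.
    have ker2 t : t *+ 2 = 0 -> t != 0 -> pi t != 0.
      move=> t2' t0; rewrite ker; apply: contra t0 => /cycleP[k tk].
      rewrite tk FinRing.zmodXgE -order_dvd_mulrn.
      rewrite -(Gauss_dvdr (n := 2)) ?coprimen2 // order_dvd_mulrn mulnC mulrnA.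
      by rewrite -[y *+ k]FinRing.zmodXgE -tk t2'.
    apply/lift/IH.
    + have : (1 < #[y]%g)%N by rewrite order_gt1.
      have : (0 < #|Q|)%N by apply/card_gt0P; exists 0.
      rewrite cG; nia.
    + exists (pi t1), (pi t2); split; rewrite -?raddfMn ?d1 ?d2 ?raddf0 ?ker2 //.
      rewrite -subr_eq0 -raddfB ker2 //; last by rewrite subr_eq0.
      by rewrite mulrnBl d1 d2 subrr.
    + by case: gt2 => g g2; exists (pi g); rewrite -raddfMn ker.
  set N := #[y]%g in oy; have N1 : (1 < N)%N by rewrite order_gt1.
  have ev k : ~~ odd k -> t1 *+ k = 0.
    by move=> ek; rewrite -[k]odd_double_half (negbTE ek) add0n -mul2n mulrnA d1 mul0rn.
  have xk k : (y + t1) *+ k = y *+ k + t1 *+ k by rewrite mulrnDl.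
  have oN : (y + t1) *+ N.+1 = y.
    rewrite xk ev /= ?oy // addr0 mulrSr (_ : y *+ N = 0) ?add0r //.
    by apply/eqP; rewrite -order_dvd_mulrn.
  pose x := y + t1.
  have ox : #[x]%g = (2 * N)%N.
    have ord k : (#[x]%g %| k)%N = (2 * N %| k)%N.
      rewrite Gauss_dvd ?coprime2n // order_dvd_mulrn xk dvdn2.
      apply/eqP/andP => [yk0|[ek /eqP]].
        have Nk : (N %| k)%N.
          rewrite -(Gauss_dvdr (n := 2)) ?coprimen2 // order_dvd_mulrn mulnC mulrnA.
          rewrite -[y *+ k](addrK (t1 *+ k)) yk0 add0r mulNrn -mulrnA ev ?oppr0 //.
          by rewrite oddM andbF.
        split=> //; apply: contra n1 => ok.
        move: yk0; rewrite (_ : y *+ k = 0) ?add0r; last first.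
          by apply/eqP; rewrite -order_dvd_mulrn.
        by rewrite -[k]odd_double_half ok mulrSr ev ?odd_double // add0r => ->.
      move=> Nk; rewrite ev // addr0; apply/eqP; rewrite -order_dvd_mulrn.
      by rewrite /dvdn Nk.
    by apply/eqP; rewrite eqn_dvd; apply/andP; split; [rewrite ord | rewrite -ord].
  apply: (good_cyclic_by_two_torsion ox) => // g.
  have /cycleP[i gi] := le2 g.
  (* [N.+1./2] halves inside [<[y]>]: the subtracted multiple of [y] has the same double as [g], so
     2-torsion remains; and [y] is [x *+ N.+1]. *)
  exists (g - y *+ (i * N.+1./2)), (N.+1 * (i * N.+1./2))%N.
  split; last by rewrite [x *+ _]mulrnA (oN : x *+ N.+1 = y) subrK.
  rewrite mulrnBl -mulrnA gi -mulnA muln2 halfK /= oy subn0 mulnC mulrnA mulrSr.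
  by rewrite (_ : y *+ N = 0) ?add0r ?subrr //; apply/eqP; rewrite -order_dvd_mulrn.
have two_power (g : G) : exists k, g *+ (2 ^ k) = 0.
  pose o := #[g]%g; exists (logn 2 o); apply/eqP.
  move: no_odd; rewrite negb_exists => /forallP/(_ (g *+ (2 ^ logn 2 o))).
  rewrite negb_and negbK => /orP[//|]; rewrite (_ : odd _) //.
  rewrite -FinRing.zmodXgE orderXdiv -/o -p_part ?dvdn_part //.
  rewrite -[X in (X %/ _)%N](partnC 2%N (order_gt0 g : 0 < o)%N).
  by rewrite mulKn ?odd_2'nat ?part_pnat ?part_gt0.
have ord4 (g : G) : g *+ 2 != 0 -> exists k, (g *+ k) *+ 2 != 0 /\ (g *+ k) *+ 4 = 0.
  have [k gk] := two_power g; elim: k g gk => [|k IHk] g gk g2.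
    by rewrite -[g]mulr1n -(expn0 2) gk mul0rn eqxx in g2.
  have [g4|g4] := eqVneq (g *+ 4) 0; first by exists 1%N; rewrite mulr1n.
  have [||j [j1 j2]] := IHk (g *+ 2); first by rewrite -mulrnA -expnS.
    by rewrite -mulrnA.
  by exists (2 * j)%N; rewrite !mulrnA in j1 j2 *.
have [x1 [x1w x14]] : exists x1 : G, x1 *+ 2 != 0 /\ x1 *+ 4 = 0.
  by have [k zk] := ord4 z z2; exists (z *+ k).
pose w := x1 *+ 2.
have w2 : w *+ 2 = 0 by rewrite -mulrnA.
have [/existsP[x2 /and3P[/eqP x24 x20 x2w]]|no_x2] :=
  boolP [exists x2 : G, [&& x2 *+ 4 == 0, x2 *+ 2 != 0 & x2 *+ 2 != w]].
  pose w' := x2 *+ 2.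
  have w'2 : w' *+ 2 = 0 by rewrite -mulrnA.
  have w0' : w' != 0 by [].
  have ww' : w != w' by rewrite eq_sym.
  have kV (a b g : G) : a *+ 2 = 0 -> b *+ 2 = 0 -> g \in klein_seq a b -> g *+ 2 = 0.
    move=> a2 b2; rewrite !inE => /or4P[] /eqP ->;
    by rewrite ?mulrnDl ?mul0rn ?a2 ?b2 ?addr0.
  (* Modulo [w'] and a further involution [v], the elements [x2] and [w] become involutions, and the
     double [w] of [x1] survives. *)
  have [/exists_inP[v /two_torsionP v2 vn]|Vk] :=
    boolP [exists v in two_torsion G, v \notin klein_seq w w'].
    move: (vn); rewrite !inE !negb_or => /and4P[v0 vw vw' vww'].
    have wn : w \notin klein_seq w' v.
      rewrite !inE !negb_or x1w ww' eq_sym vw /=; apply: contra vww' => /eqP wE.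
      by rewrite {1}wE addrAC -mulr2n w'2 add0r.
    apply: (@klein_step w' v x2 w x1) => //; rewrite -/w -/w' ?w2.
    - by rewrite eq_sym.
    - by rewrite !inE eqxx orbT.
    - exact: mem_head.
    - by apply: contra x20 => /(kV _ _ _ w'2 v2) ->.
    - by apply: contra x20 => /(kV _ _ _ w'2 v2); rewrite mulrnBl w2 subr0 => /eqP.
  have Vk' g : g *+ 2 = 0 -> g \in klein_seq w w'.
    move=> g2; move: Vk; rewrite negb_exists_in => /forall_inP/(_ g).
    by rewrite negbK; apply; apply/two_torsionP.
  (* Now [w] and [w'] generate the 2-torsion. Modulo it [x1] and [x2] are involutions, and an
     element with [g *+ 4 != 0] keeps a nonzero double. Without such an element, every double is the
     double of a combination of [x1] and [x2], and so is every involution; hence these generate [G],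
     of type Z_4 x Z_4. *)
  have [/existsP[g g4]|all4] := boolP [exists g : G, g *+ 4 != 0].
    apply: (@klein_step w w' x1 x2 g) => //; rewrite -/w -/w'.
    - by rewrite !inE eqxx orbT.
    - by rewrite !inE eqxx !orbT.
    - by apply: contra x1w => /(kV _ _ _ w2 w'2) ->.
    - by apply: contra x20 => /(kV _ _ _ w2 w'2) ->.
    - apply: contra ww' => /(kV _ _ _ w2 w'2); rewrite mulrnBl => /eqP.
      by rewrite subr_eq0.
    - by apply: contra g4 => /(kV _ _ _ w2 w'2); rewrite -mulrnA => ->.
  have inV v : v *+ 2 = 0 -> exists a b, v = (x1 *+ a + x2 *+ b) *+ 2.
    move/Vk'; rewrite !inE => /or4P[] /eqP ->.
    - by exists 0%N, 0%N; rewrite !mulr0n addr0 mul0rn.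
    - by exists 1%N, 0%N; rewrite mulr0n addr0.
    - by exists 0%N, 1%N; rewrite mulr0n add0r.
    - by exists 1%N, 1%N; rewrite mulrnDl.
  have gen g : exists a b, g = x1 *+ a + x2 *+ b.
    have g4 : (g *+ 2) *+ 2 = 0.
      move: all4; rewrite negb_exists => /forallP/(_ g); rewrite negbK -mulrnA.
      by move/eqP.
    have [a [b gab]] := inV _ g4.
    have [|c [d gcd]] := inV (g - (x1 *+ a + x2 *+ b)).
      by rewrite mulrnBl gab subrr.
    exists (a + c * 2)%N, (b + d * 2)%N; apply/eqP.
    by rewrite !mulrnDr !mulrnA addrACA -mulrnDl -gcd addrC subrK.
  apply: (good_Z4Z4 x14 x24 gen).
  have [Q [pi [surj ker cG _]]] := klein_quotient w2 w'2 x1w w0' ww'.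
  have p1 : pi x1 *+ 2 = 0 by rewrite -raddfMn; apply/eqP; rewrite ker !inE eqxx orbT.
  have p2 : pi x2 *+ 2 = 0 by rewrite -raddfMn; apply/eqP; rewrite ker !inE eqxx !orbT.
  have u : uniq (klein_seq (pi x1) (pi x2)).
    apply: klein_seq_uniq => //.
    - by rewrite ker; apply: contra x1w => /(kV _ _ _ w2 w'2) ->.
    - by rewrite ker; apply: contra x20 => /(kV _ _ _ w2 w'2) ->.
    - rewrite -subr_eq0 -raddfB ker; apply: contra ww'.
      move=> /(kV _ _ _ w2 w'2); rewrite mulrnBl => /eqP.
      by rewrite subr_eq0.
  rewrite cG (_ : #|Q| = 4) // -[RHS]/(size (klein_seq (pi x1) (pi x2))).
  rewrite -(card_uniqP u); apply: eq_card => q; rewrite inE; apply/esym.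
  have [g <-] := surj q; have [a [b ->]] := gen g; rewrite raddfD !raddfMn.
  have mulk c n : c \in klein_seq (pi x1) (pi x2) -> c *+ n \in klein_seq (pi x1) (pi x2).
    move=> ck; elim: n => [|n IHn]; first by rewrite mulr0n mem_head.
    by rewrite mulrS klein_seqD.
  by apply: klein_seqD => //; apply: mulk; rewrite !inE eqxx ?orbT.
have only_w (g : G) : g *+ 4 = 0 -> g *+ 2 = 0 \/ g *+ 2 = w.
  move=> g4; have [|g2] := eqVneq (g *+ 2) 0; [by left | right].
  move: no_x2; rewrite negb_exists => /forallP/(_ g).
  by rewrite g4 eqxx g2 negbK => /eqP.
have pow2 (g : G) : exists m, #[g]%g = (2 ^ m)%N.
  have [l gl] := two_power g; have : (#[g]%g %| 2 ^ l)%N by rewrite order_dvd_mulrn gl.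
  by case/dvdn_pfactor => // m _ om; exists m.
case: (@arg_maxnP G x1 predT (fun g => #[g]%g) isT) => x _ max_x.
have max_o (g : G) : (#[g]%g <= #[x]%g)%N := max_x g isT.
have [m om] := pow2 x; have [m1 om1] := pow2 x1.
have m2 : (2 <= m)%N.
  apply: (@leq_trans m1).
    rewrite ltnNge; apply: contra x1w => m11; rewrite -order_dvd_mulrn om1.
    by rewrite -[X in (_ %| X)%N](expn1 2) dvdn_exp2l.
  by rewrite -(leq_exp2l (m := 2)) // -om1 -om.
pose s := (2 ^ m.-1)%N.
have ox : #[x]%g = (2 * s)%N by rewrite om -expnS prednK //; lia.
have exp_s (g : G) : g *+ (2 * s) = 0.
  apply/eqP; rewrite -order_dvd_mulrn -ox om; have [mg og] := pow2 g.
  by rewrite og dvdn_exp2l // -(leq_exp2l (m := 2)) // -og -om.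
have [r sr] : exists r, s = (r * 2)%N.
  by exists (2 ^ m.-2)%N; rewrite /s -expnSr; congr (_ ^ _)%N; lia.
have s0 : (0 < s)%N by rewrite expn_gt0.
have xs : x *+ s = w.
  have [] := only_w (x *+ r); rewrite -!mulrnA ?sr //.
    by rewrite (_ : (r * 4 = 2 * s)%N) ?exp_s // sr; lia.
  move/eqP; rewrite -order_dvd_mulrn ox sr => /dvdn_leq; lia.
(* From [g *+ 2 = v + x *+ i], multiplication by [s] shows that [i] is even. The double of
   [g - x *+ i./2] is then [v], hence 0 or [w] by [only_w]; in the second case [x *+ r], whose
   double is [x *+ s = w], corrects it. *)
have gen l (g : G) : g *+ (2 ^ l) = 0 -> exists v i, v *+ 2 = 0 /\ g = v + x *+ i.
  elim: l g => [|l IHl] g gl.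
    by exists g, 0%N; rewrite mulr0n addr0 -[g]mulr1n gl mul0rn.
  have [|v [i [v2 gv]]] := IHl (g *+ 2); first by rewrite -mulrnA -expnS.
  have [oi|ei] := boolP (odd i).
    case/eqP: x1w; rewrite -/w -xs; have := exp_s g.
    rewrite mulrnA gv mulrnDl [v *+ s](_ : _ = 0) ?add0r; last first.
      by rewrite sr mulnC mulrnA v2 mul0rn.
    rewrite -mulrnA -[i]odd_double_half oi mulnDl mul1n mulrnDr.
    by rewrite -muln2 -mulnA mulnC mulrnA exp_s mul0rn addr0.
  have i2 : i = (i./2 * 2)%N by rewrite muln2 -[LHS]odd_double_half (negbTE ei).
  have g'2 : (g - x *+ i./2) *+ 2 = v.
    by rewrite mulrnBl gv -mulrnA -i2 addrK.
  have [|g'0|g'w] := only_w (g - x *+ i./2).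
  - by rewrite (_ : 4%N = (2 * 2)%N) // mulrnA g'2.
  - by exists (g - x *+ i./2), i./2; rewrite subrK.
  - exists (g - x *+ (i./2 + r)), (i./2 + r)%N; rewrite subrK; split=> //.
    by rewrite mulrnDr opprD addrA mulrnBl g'w -mulrnA -sr xs subrr.
apply: (good_cyclic_by_two_torsion ox) => //.
  by rewrite sr; lia.
by move=> g; have [l gl] := two_power g; apply: gen gl.
Qed.

End Step.

Theorem good_of_noncyclic2 (G : finZmodType) :
  noncyclic2 G -> (exists z : G, z *+ 2 != 0) -> good G.
Proof.
have [n] := ubnP #|G|; elim: n G => // n IHn G ltGn.
by apply: good_step => Q ltQG; apply: IHn; apply: leq_trans ltQG _.
Qed.

(** * Application to the quotient of the windmill's group *)

Lemma noncyclic2_Z2_Z2s (s : nat) (Q : finZmodType) (f : 'Z_2 * 'Z_(2 * s) -> Q) :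
  (2 <= s)%N -> injective f -> {morph f : a b / (a * b)%g >-> a + b} ->
  noncyclic2 Q /\ exists z : Q, z *+ 2 != 0.
Proof.
move=> s2 f_inj fM.
have f1 : f 1%g = 0 by apply: (addrI (f 1%g)); rewrite -fM mulg1 addr0.
have f0 a : (f a == 0) = (a == 1%g) by rewrite -f1 (inj_eq f_inj).
have f2 a : f a *+ 2 = f (a * a)%g by rewrite mulr2n fM.
have s1 : (1 < 2 * s)%N by lia.
have natE k : (k < 2 * s)%N -> (k%:R : 'Z_(2 * s)) = k :> nat.
  by move=> lt_k; rewrite val_Zp_nat // modn_small.
(* [a] and [b] are the two involutions; the double of [c] is nonzero because [s] is at least 2. *)
pose a : 'Z_2 * 'Z_(2 * s) := (1, 0); pose b : 'Z_2 * 'Z_(2 * s) := (0, s%:R).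
pose c : 'Z_2 * 'Z_(2 * s) := (0, 1).
have sn0 : (s%:R : 'Z_(2 * s)) != 0.
  by rewrite -val_eqE /= natE; lia.
have two_neq0 : (2%:R : 'Z_(2 * s)) != 0.
  apply/eqP => e0; have : (2 < 2 * s)%N by lia.
  by move/natE; rewrite e0.
split.
  exists (f a), (f b); rewrite !f2; split.
  - by apply/eqP; rewrite f0 -[(a * a)%g]/(1 + 1, 0 + 0) addr0.
  - apply/eqP; rewrite f0 -[(b * b)%g]/(0 + 0, s%:R + s%:R) addr0 -natrD.
    by rewrite addnn -mul2n char_Zp.
  - by rewrite f0.
  - by rewrite f0 xpair_eqE negb_and sn0 orbT.
  - by rewrite (inj_eq f_inj).
exists (f c); rewrite f2 f0 -[(c * c)%g]/(0 + 0, 1 + 1) -[1 + 1]/(2%:R).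
by rewrite xpair_eqE negb_and; apply/orP; right.
Qed.

Local Close Scope ring_scope.

Theorem theorem6p3 (n m : nat) (n_ge4 : 4 <= n) (n_even : ~~ odd n)
    (m_ge3 : 3 <= m) (m_odd : odd m)
    (Gamma : finZmodType) (card_Gamma : #|Gamma| = m * n)
    (H : {group Gamma}) (card_H : #|H| = m)
    (K_sub : exists s : nat, 2 <= s /\
       exists L : {group coset_of H},
         L \subset ([set: Gamma] / H)%g /\
         L \isog [set: ('Z_2 * 'Z_(2 * s))%type]) :
  harmonious (@dutch_windmill n m) Gamma.
Proof.
have [s [s2 [L [_ isoL]]]] := K_sub.
have [Q [pi [phi [surj ker cG phi_inj phiM]]]] := quotient_zmod H.
have /isogP[f injf _] : [set: ('Z_2 * 'Z_(2 * s))%type] \isog L by rewrite isog_sym.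
have [nc ne] : noncyclic2 Q /\ exists z : Q, (z *+ 2 != 0)%R.
  apply: (@noncyclic2_Z2_Z2s s Q (phi \o f)) => //.
    by move=> a b /phi_inj /(injmP injf); apply; rewrite inE.
  by move=> a b /=; rewrite morphM ?inE.
have [U [V [W [hs _ _ _]]]] := good_of_noncyclic2 nc ne.
apply: (@dutch_windmill_harmonious Gamma Q pi n m H _ _ ker _ surj _ _ _ _ hs) => //.
- move=> g gH; apply/eqP; rewrite -order_dvd_mulrn -card_H.
  exact: order_dvdG.
- have: (m * n = m * #|Q|)%N by rewrite -card_Gamma cG card_H.
  by move/eqP; rewrite eqn_pmul2l ?(ltn_trans _ m_ge3) // => /eqP.
Qed.
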